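(* Let $G$ be a directed graph with finitely many vertices and let $G=G_1\cup G_2$, where $G_1,G_2$ are non-empty subgraphs of $G$ that share only some vertices but no edges. Suppose that $G_2^0=G^0$, $G_1^0\neq G^0$, and no edge of $G_2$ enters $G_1$. Let $v_1,\dots,v_n$ be the vertices shared by $G_1$ and $G_2$ (so $n$ is their number). For a vertex $v$ of $G_1$ let $\bar p_v$ denote the corresponding projection in $C^*(G_1)$, and for a vertex $v$ of $G_2$ let $\bar{\bar p}_v$ denote the corresponding projection in $C^*(G_2)$. Then $$C^*(G)\cong \left(C^*(G_1)\oplus\mathbb C\right)\ast_{\mathbb C^{n+1}} C^*(G_2),$$ where the right-hand side is the unital full amalgamated free product with respect to the unital embeddings $\theta_1:\mathbb C^{n+1}\to C^*(G_1)\oplus\mathbb C$ and $\theta_2:\mathbb C^{n+1}\to C^*(G_2)$ defined by $$\theta_1(\lambda_1,\dots,\lambda_{n+1})=\Big(\sum_{i=1}^n\lambda_i\bar p_{v_i},\ \lambda_{n+1}\Big),\qquad \theta_2(\lambda_1,\dots,\lambda_{n+1})=\sum_{i=1}^n\lambda_i\bar{\bar p}_{v_i}+\lambda_{n+1}\sum_{v\in G_2^0\setminus G_1^0}\bar{\bar p}_v$$ for $\lambda_1,\dots,\lambda_{n+1}\in\mathbb C$.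
   Context: A directed graph $G=(G^0,G^1,s,r)$ consists of countable sets $G^0$ (vertices) and $G^1$ (edges) and maps $s,r:G^1\to G^0$ (source and range). The graph C*-algebra $C^*(G)$ is the universal C*-algebra generated by mutually orthogonal projections $p_v$ ($v\in G^0$) and partial isometries $s_e$ ($e\in G^1$) with mutually orthogonal ranges, subject to: (1) $s_e^*s_e=p_{s(e)}$ for each $e\in G^1$; (2) $p_v=\sum_{e\in r^{-1}(v)}s_es_e^*$ for each $v\in G^0$ with $0<\sharp(r^{-1}(v))<\infty$; (3) $s_es_e^*\le p_{r(e)}$ for each $e\in G^1$. If $G^0$ is finite, $C^*(G)$ is unital with unit $\sum_{v}p_v$. $G=G_1\cup G_2$ means that $G_1,G_2$ are subgraphs with $G^0=G_1^0\cup G_2^0$ and $G^1=G_1^1\cup G_2^1$. ''No edge of $G_2$ enters $G_1$'' means that $r(e)\notin G_1^0$ for every $e\in G_2^1$. Given unital C*-algebras $A,B,D$ and unital embeddings $\theta_A:D\to A$, $\theta_B:D\to B$, the unital full amalgamated free product $A\ast_D B$ is the C*-algebra $C$ equipped with unital embeddings $i_A:A\to C$, $i_B:B\to C$ with $i_A\circ\theta_A=i_B\circ\theta_B$, generated by $i_A(A)\cup i_B(B)$, such that whenever $\mathcal E$ is a unital C*-algebra and $\pi_A:A\to\mathcal E$, $\pi_B:B\to\mathcal E$ are unital $*$-homomorphisms with $\pi_A\circ\theta_A=\pi_B\circ\theta_B$, there is a unital $*$-homomorphism $\pi:C\to\mathcal E$ with $\pi\circ i_A=\pi_A$ and $\pi\circ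 i_B=\pi_B$. *)

(* Defs.v *)
From HB Require Import structures.
From mathcomp Require Import all_boot all_order all_algebra.
From mathcomp Require Import complex lra.
From mathcomp Require Import all_classical reals interval_inference.
From mathcomp Require Import prodnormedzmodule topology normedtype.

Set Implicit Arguments.
Unset Strict Implicit.
Unset Printing Implicit Defensive.

Import Order.TTheory GRing.Theory Num.Theory.
Import numFieldNormedType.Exports.

Local Open Scope classical_set_scope.
Local Open Scope complex_scope.
Local Open Scope ring_scope.

HB.instance Definition _ (R : realType) := NormedModule.copy R[i] R[i]^o.

Lemma ball_complexP (R : realType) (z w : R[i]) (e : R) :
  ball (complex.Re z) (e / 2) (complex.Re w) ->
  ball (complex.Im z) (e / 2) (complex.Im w) -> ball z e%:C w.
Proof.
rewrite -!ball_normE /= -!raddfB => hr hi.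
rewrite normc_def ltcR.
set a := complex.Re _ in hr *; set b := complex.Im _ in hi *.
have e0 : 0 < e.
  by have := le_lt_trans (normr_ge0 _) hr; rewrite ltr_pdivlMr // mul0r.
rewrite -(ltr_sqr (sqrtr_ge0 _) (ltW e0)) sqr_sqrtr ?addr_ge0 ?sqr_ge0//.
have H (x : R) : `|x| < e / 2 -> x ^+ 2 < (e / 2) ^+ 2.
  move=> h; rewrite -real_normK ?num_real//.
  by rewrite ltr_sqr ?nnegrE ?divr_ge0 ?(ltW e0).
apply: (lt_le_trans (ltrD (H _ hr) (H _ hi))).
have := sqr_ge0 e; rewrite expr_div_n; lra.
Qed.

Lemma complex_complete (R : realType) (F : set_system R[i]) :
  ProperFilter F -> cauchy F -> cvg F.
Proof.
move=> FF /cauchy_ballP Fc.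
have lec (z w : R[i]) (e : R) : ball z e%:C w ->
    ball (complex.Re z) e (complex.Re w) /\
    ball (complex.Im z) e (complex.Im w).
  rewrite -!ball_normE /= -!raddfB normc_def ltcR => h.
  split; apply: le_lt_trans h.
    by rewrite -sqrtr_sqr ler_wsqrtr// lerDl sqr_ge0.
  by rewrite -sqrtr_sqr ler_wsqrtr// lerDr sqr_ge0.
have cC (f : R[i] -> R) :
    (forall z w e, ball z e%:C w -> ball (f z) e (f w)) -> cvg (f @ F).
  move=> fl; apply: cauchy_cvg; apply/cauchy_ballP => e e0.
  have e0C : 0 < e%:C by rewrite ltcR.
  have [[P Q] /= [FP FQ] PQ] := Fc _ e0C.
  exists (f @` P, f @` Q).
    by split; apply: filterS (@preimage_image _ _ f _) _.
  by move=> [_ _] /= [[x Px <-] [y Qy <-]]; apply: fl; apply: (PQ (x, y)).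
have cR : cvg (@complex.Re R @ F) by apply: cC => z w e /lec[].
have cI : cvg (@complex.Im R @ F) by apply: cC => z w e /lec[].
apply/cvg_ex; exists (lim (@complex.Re R @ F) +i* lim (@complex.Im R @ F)).
apply/cvg_ballP => -[a b]; rewrite ltcE /= => /andP[/eqP -> a0].
have a2 : 0 < a / 2 by rewrite divr_gt0.
near=> z; apply: ball_complexP => /=; near: z.
  by move/cvg_ballP : cR; apply.
by move/cvg_ballP : cI; apply.
Unshelve. all: by end_near. Qed.

HB.instance Definition _ (R : realType) :=
  Uniform_isComplete.Build R[i] (@complex_complete R).

HB.instance Definition _ (R : realType) (m n : nat) :=
  Complete.on 'M[R[i]]_(m, n).

HB.instance Definition _ (T U : puniformType) := Pointed.on (T * U)%type.

Lemma prod_complete (T U : completeType) (F : set_system (T * U)) :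
  ProperFilter F -> cauchy F -> cvg F.
Proof.
move=> FF Fc.
have c1 : cvg (fst @ F).
  apply: cauchy_cvg => A entA.
  have [[P Q] /= [FP FQ] PQ] := Fc _ (prod_entP entA (@entourageT U)).
  exists (fst @` P, fst @` Q).
    by split; apply: filterS (@preimage_image _ _ fst _) _.
  by move=> [_ _] /= [[x Px <-] [y Qy <-]]; have [] := PQ (x, y) (conj Px Qy).
have c2 : cvg (snd @ F).
  apply: cauchy_cvg => A entA.
  have [[P Q] /= [FP FQ] PQ] := Fc _ (prod_entP (@entourageT T) entA).
  exists (snd @` P, snd @` Q).
    by split; apply: filterS (@preimage_image _ _ snd _) _.
  by move=> [_ _] /= [[x Px <-] [y Qy <-]]; have [] := PQ (x, y) (conj Px Qy).
apply/cvg_ex; exists (lim (fst @ F), lim (snd @ F)).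
rewrite [F](_ : _ = (fun x => (x.1, x.2)) @ F); last first.
  by rewrite predeqE => A; split; rewrite /fmap /=; apply: filterS => -[].
exact: cvg_pair.
Qed.

HB.instance Definition _ (T U : completeType) :=
  Uniform_isComplete.Build (T * U)%type (@prod_complete T U).

HB.instance Definition _ (R : realType) (A B : completeNormedModType R[i]) :=
  Complete.on (A * B)%type.

(* Not assumed unital: the product is therefore a separate operation [cmul],
   unrelated to the (unital) ring product of MathComp.  As usual for normed
   modules over [R[i]], the norm takes its values in [R[i]]; they are
   nonnegative reals there.  The zero algebra is allowed. *)
HB.mixin Record isCStarAlgebra (R : realType) A
    of @CompleteNormedModule R[i] A := {
  cmul : A -> A -> A;
  cstar : A -> A;
  cmulA : associative cmul;
  cmulDl : left_distributive cmul +%R;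
  cmulDr : right_distributive cmul +%R;
  cmulZl : forall (a : R[i]) (x y : A), cmul (a *: x) y = a *: cmul x y;
  cmulZr : forall (a : R[i]) (x y : A), cmul x (a *: y) = a *: cmul x y;
  cstarK : involutive cstar;
  cstarD : {morph cstar : x y / x + y};
  cstarZ : forall (a : R[i]) (x : A), cstar (a *: x) = conjc a *: cstar x;
  cstarM : forall x y : A, cstar (cmul x y) = cmul (cstar y) (cstar x);
  cnormM : forall x y : A, `|cmul x y| <= `|x| * `|y|;
  cnorm_star : forall x : A, `|cmul (cstar x) x| = `|x| ^+ 2
}.

#[short(type="cstarAlgType")]
HB.structure Definition CStarAlgebra (R : realType) :=
  {A of @CompleteNormedModule R[i] A & isCStarAlgebra R A}.

Declare Scope cstar_scope.
Delimit Scope cstar_scope with CS.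
Notation "x ** y" := (cmul x y) (at level 40, left associativity) : cstar_scope.
Notation "x ^**" := (cstar x) (at level 2, format "x ^**") : cstar_scope.
Local Open Scope cstar_scope.

Section complex_cstar.
Variable R : realType.
Implicit Types x y : R[i].

Let mul (x y : R[i]) : R[i] := x * y.

Let mulZl (a : R[i]) x y : mul (a *: x) y = a *: mul x y.
Proof. exact: (esym (mulrA _ _ _)). Qed.

Let mulZr (a : R[i]) x y : mul x (a *: y) = a *: mul x y.
Proof. exact: mulrCA. Qed.

Let conjD : {morph (@conjc R) : x y / x + y}.
Proof. by move=> x y; rewrite rmorphD. Qed.

Let conjZ (a : R[i]) x : conjc (a *: x : R[i]) = conjc a *: conjc x.
Proof. exact: rmorphM. Qed.

Let conjM x y : conjc (mul x y) = mul (conjc y) (conjc x).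
Proof. by rewrite /mul rmorphM mulrC. Qed.

Let normM x y : `|mul x y| <= `|x| * `|y|.
Proof. by rewrite normrM. Qed.

Let norm_conj x : `|mul (conjc x) x| = `|x| ^+ 2.
Proof. by rewrite /mul normrM normcJ expr2. Qed.

HB.instance Definition _ := isCStarAlgebra.Build R R[i]
  (@mulrA _) (@mulrDl _) (@mulrDr _) mulZl mulZr
  (@conjcK R) conjD conjZ conjM normM norm_conj.

End complex_cstar.

(* The direct sum of two C*-algebras; the norm is the maximum norm that
   the library puts on products. *)
Section prod_cstar.
Variables (R : realType) (A B : cstarAlgType R).
Implicit Types x y : A * B.

Definition prod_cmul x y : A * B := (x.1 ** y.1, x.2 ** y.2).
Definition prod_cstar x : A * B := (x.1^**, x.2^**).

Let mulA : associative prod_cmul.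
Proof. by move=> x y z; rewrite /prod_cmul /= !cmulA. Qed.

Let mulDl : left_distributive prod_cmul +%R.
Proof. by move=> x y z; rewrite /prod_cmul /= !cmulDl. Qed.

Let mulDr : right_distributive prod_cmul +%R.
Proof. by move=> x y z; rewrite /prod_cmul /= !cmulDr. Qed.

Let mulZl (a : R[i]) x y : prod_cmul (a *: x) y = a *: prod_cmul x y.
Proof. by rewrite /prod_cmul /= !cmulZl. Qed.

Let mulZr (a : R[i]) x y : prod_cmul x (a *: y) = a *: prod_cmul x y.
Proof. by rewrite /prod_cmul /= !cmulZr. Qed.

Let starK : involutive prod_cstar.
Proof. by move=> [x y]; rewrite /prod_cstar /= !cstarK. Qed.

Let starD : {morph prod_cstar : x y / x + y}.
Proof. by move=> x y; rewrite /prod_cstar /= !cstarD. Qed.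

Let starZ (a : R[i]) x : prod_cstar (a *: x) = conjc a *: prod_cstar x.
Proof. by rewrite /prod_cstar /= !cstarZ. Qed.

Let starM x y :
  prod_cstar (prod_cmul x y) = prod_cmul (prod_cstar y) (prod_cstar x).
Proof. by rewrite /prod_cstar /prod_cmul /= !cstarM. Qed.

Let comp x : `|x.1| >=< `|x.2|.
Proof. by rewrite real_comparable // normr_real. Qed.

Let normM x y : `|prod_cmul x y| <= `|x| * `|y|.
Proof.
rewrite !prod_normE /= comparable_ge_max; last first.
  by rewrite real_comparable // normr_real.
by apply/andP; split; apply: (le_trans (cnormM _ _));
  rewrite ler_pM // comparable_le_max ?lexx ?orbT // comp.
Qed.

Let norm_star x : `|prod_cmul (prod_cstar x) x| = `|x| ^+ 2.
Proof.
rewrite !prod_normE /= !cnorm_star.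
have [le12|lt21] := comparable_leP (comp x).
  by rewrite max_r // ler_sqr ?nnegrE.
by rewrite max_l // ler_sqr ?nnegrE // ltW.
Qed.

HB.instance Definition _ := isCStarAlgebra.Build R (A * B)%type
  mulA mulDl mulDr mulZl mulZr starK starD starZ starM normM norm_star.

End prod_cstar.

Lemma mx_norm_ge_entry (K : numDomainType) (m n : nat) (M : 'M[K]_(m, n)) i j :
  `|M i j| <= mx_norm M.
Proof.
rewrite mx_normE -[leLHS]nngE num_le.
exact: (le_bigmax _ (fun k => `|M k.1 k.2|%:nng) (i, j)).
Qed.

(* The C*-algebra of n-tuples of complex numbers: row vectors with entrywise
   operations and the maximum norm. *)
Section row_cstar.
Variables (R : realType) (n : nat).
Implicit Types x y : 'rV[R[i]]_n.

Definition row_cmul x y : 'rV[R[i]]_n := \row_j (x ord0 j * y ord0 j).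
Definition row_cstar x : 'rV[R[i]]_n := \row_j conjc (x ord0 j).

Let mulA : associative row_cmul.
Proof. by move=> x y z; apply/rowP => j; rewrite !mxE mulrA. Qed.

Let mulDl : left_distributive row_cmul +%R.
Proof. by move=> x y z; apply/rowP => j; rewrite !mxE mulrDl. Qed.

Let mulDr : right_distributive row_cmul +%R.
Proof. by move=> x y z; apply/rowP => j; rewrite !mxE mulrDr. Qed.

Let mulZl (a : R[i]) x y : row_cmul (a *: x) y = a *: row_cmul x y.
Proof. by apply/rowP => j; rewrite !mxE mulrA. Qed.

Let mulZr (a : R[i]) x y : row_cmul x (a *: y) = a *: row_cmul x y.
Proof. by apply/rowP => j; rewrite !mxE mulrCA. Qed.

Let starK : involutive row_cstar.
Proof. by move=> x; apply/rowP => j; rewrite !mxE conjcK. Qed.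

Let starD : {morph row_cstar : x y / x + y}.
Proof. by move=> x y; apply/rowP => j; rewrite !mxE rmorphD. Qed.

Let starZ (a : R[i]) x : row_cstar (a *: x) = conjc a *: row_cstar x.
Proof. by apply/rowP => j; rewrite !mxE rmorphM. Qed.

Let starM x y :
  row_cstar (row_cmul x y) = row_cmul (row_cstar y) (row_cstar x).
Proof. by apply/rowP => j; rewrite !mxE rmorphM mulrC. Qed.

Let le_entry x j : `|x ord0 j| <= `|x|.
Proof.
exact: mx_norm_ge_entry.
Qed.

Let norm_le x (c : R[i]) : 0 <= c -> (forall j, `|x ord0 j| <= c) -> `|x| <= c.
Proof.
move=> c0 xc; have [->|/mx_norm_neq0[[i j]]] := eqVneq (`|x|) 0; first by [].
by rewrite -[mx_norm x]/(`|x|) => -> /=; rewrite (ord1 i).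
Qed.

Let normM x y : `|row_cmul x y| <= `|x| * `|y|.
Proof.
apply: norm_le => [|j]; first by rewrite mulr_ge0.
by rewrite mxE normrM ler_pM // le_entry.
Qed.

Let norm_star x : `|row_cmul (row_cstar x) x| = `|x| ^+ 2.
Proof.
apply/le_anti/andP; split.
  apply: norm_le => [|j]; first by rewrite exprn_ge0.
  by rewrite !mxE normrM normcJ expr2 ler_pM // le_entry.
have [->|/mx_norm_neq0[[i j]]] := eqVneq (`|x|) 0; first by rewrite expr0n normr_ge0.
rewrite -[mx_norm x]/(`|x|) => -> /=; rewrite (ord1 i).
by apply: le_trans (le_entry _ j); rewrite !mxE normrM normcJ expr2.
Qed.

HB.instance Definition _ := isCStarAlgebra.Build R 'rV[R[i]]_n
  mulA mulDl mulDr mulZl mulZr starK starD starZ starM normM norm_star.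

End row_cstar.

Section cstar_theory.
Variable R : realType.
Implicit Types A B C D : cstarAlgType R.

Definition is_unit A (u : A) : Prop := forall x : A, u ** x = x /\ x ** u = x.

Definition unital A : Prop := exists u : A, is_unit u.

Definition projection A (p : A) : Prop := p^** = p /\ p ** p = p.

Definition partial_isometry A (s : A) : Prop := s ** s^** ** s = s.

(* The usual order on projections: [q] is a subprojection of [p]. *)
Definition proj_le A (q p : A) : Prop := q ** p = q /\ p ** q = q.

(* Continuity is not required: such maps are automatically contractive. *)
Definition starhom A B (f : A -> B) : Prop :=
  [/\ linear f,
      forall x y, f (x ** y) = f x ** f y &
      forall x, f x^** = (f x)^** ].

Definition unital_starhom A B (f : A -> B) : Prop :=
  [/\ starhom f, unital A, unital B & forall u, is_unit u -> is_unit (f u)].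

Definition unital_embedding A B (f : A -> B) : Prop :=
  unital_starhom f /\ injective f.

Definition star_isomorphic A B : Prop :=
  exists f : A -> B, starhom f /\ bijective f.

Record closed_star_subalgebra A (S : set A) : Prop := {
  css_0 : S 0;
  css_linear : forall (a : R[i]) x y, S x -> S y -> S (a *: x + y);
  css_mul : forall x y, S x -> S y -> S (x ** y);
  css_star : forall x, S x -> S x^**;
  css_closed : closed S
}.

Definition generated_by A (X : set A) : Prop :=
  forall S : set A, closed_star_subalgebra S -> X `<=` S -> S = setT.

(* [C], with [iA] and [iB], is the unital full amalgamated free product of
   [A] and [B] over [D] with respect to [thA] and [thB]. *)
Record amalgamated_free_product D A B (thA : D -> A) (thB : D -> B)
    C (iA : A -> C) (iB : B -> C) : Prop := {
  afp_thA : unital_embedding thA;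
  afp_thB : unital_embedding thB;
  afp_iA : unital_embedding iA;
  afp_iB : unital_embedding iB;
  afp_amalgam : iA \o thA = iB \o thB;
  afp_generated : generated_by (range iA `|` range iB);
  afp_universal : forall (E : cstarAlgType R) (piA : A -> E) (piB : B -> E),
    unital_starhom piA -> unital_starhom piB -> piA \o thA = piB \o thB ->
    exists pi : C -> E,
      [/\ unital_starhom pi, pi \o iA = piA & pi \o iB = piB]
}.

End cstar_theory.

(* The vertices and edges are sets inside ambient types [V] and [E], so that
   subgraphs of a graph are again graphs over the same types.  The values of
   [src] and [rng] outside [edges] are irrelevant. *)
Record digraph (V E : choiceType) := Digraph {
  vertices : set V;
  edges : set E;
  src : E -> V;
  rng : E -> V;
  countable_vertices : countable vertices;
  countable_edges : countable edges;
  src_vertices : forall e, edges e -> vertices (src e);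
  rng_vertices : forall e, edges e -> vertices (rng e)
}.

Section graphs.
Variables V E : choiceType.
Implicit Types G H : digraph V E.

Definition nonempty_graph G : Prop := vertices G !=set0.

Definition subgraph H G : Prop :=
  [/\ vertices H `<=` vertices G, edges H `<=` edges G &
      forall e, edges H e -> src H e = src G e /\ rng H e = rng G e].

Definition graph_union G G1 G2 : Prop :=
  [/\ subgraph G1 G, subgraph G2 G,
      vertices G = vertices G1 `|` vertices G2 &
      edges G = edges G1 `|` edges G2].

Definition receives G (v : V) : set E := [set e | edges G e /\ rng G e = v].

Definition no_edge_enters G2 G1 : Prop :=
  forall e, edges G2 e -> ~ vertices G1 (rng G2 e).

(* The values of [p] and [s] outside the graph are irrelevant. *)
Record graph_family G (R : realType) (A : cstarAlgType R)
    (p : V -> A) (s : E -> A) : Prop := {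
  gf_proj : forall v, vertices G v -> projection (p v);
  gf_proj_orth : forall v w, vertices G v -> vertices G w -> v <> w ->
    p v ** p w = 0;
  gf_pisom : forall e, edges G e -> partial_isometry (s e);
  gf_range_orth : forall e f, edges G e -> edges G f -> e <> f ->
    (s e ** (s e)^**) ** (s f ** (s f)^**) = 0;
  gf_source : forall e, edges G e -> (s e)^** ** s e = p (src G e);
  gf_sum : forall v, vertices G v ->
    receives G v !=set0 -> finite_set (receives G v) ->
    p v = \sum_(e \in receives G v) s e ** (s e)^**;
  gf_range : forall e, edges G e -> proj_le (s e ** (s e)^**) (p (rng G e))
}.

(* [A], with [p] and [s], is the graph C*-algebra of [G]. *)
Record graph_cstar G (R : realType) (A : cstarAlgType R)
    (p : V -> A) (s : E -> A) : Prop := {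
  gc_family : graph_family G p s;
  gc_generated : generated_by ((p @` vertices G) `|` (s @` edges G));
  gc_universal : forall (B : cstarAlgType R) (q : V -> B) (t : E -> B),
    graph_family G q t ->
    exists f : A -> B,
      [/\ starhom f, forall v, vertices G v -> f (p v) = q v &
          forall e, edges G e -> f (s e) = t e]
}.

End graphs.

Section theta.
Variables (R : realType) (V E : choiceType) (n : nat) (v : 'I_n -> V).

Let coord (l : 'rV[R[i]]_n.+1) (i : 'I_n) : R[i] :=
  l ord0 (widen_ord (leqnSn n) i).

Definition theta1 (A1 : cstarAlgType R) (p1 : V -> A1)
    (l : 'rV[R[i]]_n.+1) : A1 * R[i] :=
  (\sum_(i < n) coord l i *: p1 (v i), l ord0 ord_max).

Definition theta2 (G1 G2 : digraph V E) (A2 : cstarAlgType R) (p2 : V -> A2)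
    (l : 'rV[R[i]]_n.+1) : A2 :=
  \sum_(i < n) coord l i *: p2 (v i) +
  l ord0 ord_max *: \sum_(w \in vertices G2 `\` vertices G1) p2 w.

End theta.

(* Main.v *)
Require Import Defs.
From HB Require Import structures.
From mathcomp Require Import all_boot all_order all_algebra.
From mathcomp Require Import complex ring lra.
From mathcomp Require Import all_classical reals topology normedtype sequences.

(** Both algebras have the same generators and relations.  A graph family of
    [G] in a C*-algebra is the same thing as a graph family of [G1] and a graph
    family of [G2] that agree on the shared vertices.  Indeed, since no edge
    of [G2] enters [G1], every vertex receives all its edges from one of the
    two subgraphs, so each of the relations summing over the edges into a
    vertex involves only one of them; the ranges of an edge of [G1] and of an
    edge of [G2] lie below the projections of two different vertices and are
    orthogonal ([graph_family_glue], [graph_family_sub]).  The universal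
    properties therefore give homomorphisms [f : A -> C] and [g : C -> A].
    The extra summand of [A1 * R[i]] makes the first factor unital with a unit
    matching that of [A2]: its unit is sent by [g] to the sum of the
    projections of the vertices outside [G1].

    Both composites fix the generators.  Concluding that they are identities,
    when homomorphisms are not assumed continuous, needs the automatic
    contractivity of star-homomorphisms.  It is proved here without spectral
    theory.  If [h] is self-adjoint of norm less than 1, then
    [1 - h ^ 2 = (1 - g) ^ 2] for some self-adjoint [g] commuting with [h],
    obtained as a fixed point ([half_root]).  Any homomorphism [f] preserves
    this identity, so that [1 - f g + i f h] is formally unitary and [f h], as
    half the difference of two unitaries up to a scalar, has norm at most 1
    ([starhom_contractive], [starhom_ext]).

    The maps [theta1] and [theta2] are injective if no vertex projection of a
    graph C*-algebra vanishes ([graph_cstar_proj_neq0]).  This requires a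
    C*-algebra with a graph family of nonzero projections, and one is built
    from scratch: the bounded operators on the Hilbert space of
    square-summable sequences ([bop]).  Each vertex [v] gets an infinite set
    [D v] of coordinates, these sets being disjoint; when [v] receives an edge,
    [D v] is in bijection with the disjoint union of the sets [D (src e)] over
    the edges [e] into [v], and the edge [e] acts as the partial shift along
    this bijection ([faithful_graph_family]). *)

Set Implicit Arguments.
Unset Strict Implicit.
Unset Printing Implicit Defensive.

Import Order.TTheory GRing.Theory Num.Theory.
Import numFieldNormedType.Exports.

Local Open Scope classical_set_scope.
Local Open Scope complex_scope.
Local Open Scope ring_scope.
Local Open Scope cstar_scope.

(** * Real-valued norms and closed sets *)

Section real_norm.
Variables (R : realType) (V : normedModType R[i]).
Implicit Types (x y : V) (a : R[i]).

(** The norm of a normed module over [R[i]] takes values in [R[i]], which is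
    only partially ordered; estimates are carried out on its real part. *)
Definition rnorm x : R := complex.Re `|x|.

Lemma rnormE x : `|x| = (rnorm x)%:C.
Proof.
rewrite /rnorm; have := normr_ge0 x; case: (`|x|) => u w.
by rewrite lecE /= => /andP[/eqP-> _].
Qed.

Lemma rnorm_ge0 x : 0 <= rnorm x.
Proof. by rewrite -lecR -rnormE normr_ge0. Qed.

Lemma rnormD x y : rnorm (x + y) <= rnorm x + rnorm y.
Proof. by rewrite -lecR rmorphD /= -!rnormE ler_normD. Qed.

Lemma rnormN x : rnorm (- x) = rnorm x.
Proof. by rewrite /rnorm normrN. Qed.

Lemma rnormB x y : rnorm (x - y) = rnorm (y - x).
Proof. by rewrite -rnormN opprB. Qed.

Lemma rnorm_eq0 x : rnorm x = 0 -> x = 0.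
Proof. by move=> x0; apply: normr0_eq0; rewrite rnormE x0. Qed.

Lemma rnorm0 : rnorm (0 : V) = 0.
Proof. by rewrite /rnorm normr0. Qed.

Lemma rnormZ a x : rnorm (a *: x) = complex.Re `|a| * rnorm x.
Proof.
apply: complexI; rewrite -rnormE normrZ rnormE rmorphM /=.
by congr (_ * _).
Qed.

Lemma rnormZr (r : R) x : rnorm (r%:C *: x) = `|r| * rnorm x.
Proof. by rewrite rnormZ normc_def /= expr0n addr0 sqrtr_sqr. Qed.

Lemma closed_seq_limit (S : set V) : closed S ->
  forall x, (forall e : R, 0 < e -> exists2 y, S y & rnorm (x - y) < e) -> S x.
Proof.
move=> clS x xS; apply: clS => B /nbhs_normP[e /= e0 eB].
have e0' : 0 < complex.Re e by move: e0; rewrite ltcE => /andP[].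
have [y Sy xy] := xS _ e0'.
exists y; split=> //; apply: eB => /=.
rewrite /ball_ /= rnormE; case: e e0 xy {e0'} => er ei.
rewrite !ltcE /= => /andP[/eqP-> _] ->.
by rewrite eqxx.
Qed.

Lemma closed_rnormP (S : set V) :
  (forall x, (forall e : R, 0 < e -> exists2 y, S y & rnorm (x - y) < e) -> S x)
  -> closed S.
Proof.
move=> H x xS; apply: H => e e0.
have [|y [Sy]] := xS (ball x e%:C); first by apply: nbhsx_ballx; rewrite ltcR.
by rewrite -ball_normE /= rnormE ltcR => xy; exists y.
Qed.

Lemma closed_rnorm_le (r : R) : closed [set x : V | rnorm x <= r].
Proof.
apply: closed_rnormP => x H /=; apply/ler_addgt0Pl => e /H[y /= yr xy].
rewrite -(subrK y x) (le_trans (rnormD _ _))// lerD// ltW//.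
Qed.

End real_norm.

Section zeros.
Variables (R : realType) (V W : normedModType R[i]).

(** Equalizers, commutants and sets of self-adjoint elements are zero sets of
    this kind.  The map is additive rather than linear because the adjoint is
    conjugate linear. *)
Lemma closed_zeros (f : V -> W) (M : R) :
    (forall x y, f (x - y) = f x - f y) ->
    (forall x, rnorm (f x) <= M * rnorm x) ->
  closed [set x | f x = 0].
Proof.
move=> fB fM; apply: closed_rnormP => x H /=.
apply: rnorm_eq0; apply/le_anti; rewrite rnorm_ge0 andbT.
apply/ler_addgt0Pl => e e0; rewrite addr0.
(* [`|M| + 1] replaces [M] to divide by a positive number *)
have M0 : 0 < `|M| + 1 by rewrite ltr_wpDl.
have [|y /= fy xy] := H (e / (`|M| + 1)); first by rewrite divr_gt0.
have -> : f x = f (x - y) by rewrite fB fy subr0.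
apply: (le_trans (fM _)); apply: (@le_trans _ _ ((`|M| + 1) * rnorm (x - y))).
  by apply: ler_wpM2r; rewrite ?rnorm_ge0// (le_trans (ler_norm _))// lerDl.
by rewrite mulrC -ler_pdivlMr// ltW.
Qed.

End zeros.

(** * Fixed points of contractions *)

Section sequences.
Variable R : realType.

Lemma rcauchy_cvg (V : completeNormedModType R[i]) (u : nat -> V) :
  (forall e : R, 0 < e -> exists N, forall m n, (N <= m)%N -> (N <= n)%N ->
      rnorm (u m - u n) < e) ->
  exists l, forall e : R, 0 < e -> exists N, forall n, (N <= n)%N ->
      rnorm (l - u n) < e.
Proof.
move=> H.
have /cvg_ex[l ul] : cvg (u @ \oo).
  apply: cauchy_cvg; apply/cauchy_ballP => e e0.
  have e0' : 0 < complex.Re e by move: e0; rewrite ltcE => /andP[].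
  have [N HN] := H _ e0'.
  exists ([set u n | n in [set n | (N <= n)%N]],
          [set u n | n in [set n | (N <= n)%N]]).
    by split; exists N => // n /= Nn; exists n.
  move=> [_ _] /= [[m /= Nm <-] [n /= Nn <-]].
  rewrite -ball_normE /= rnormE (lt_le_trans (y := (complex.Re e)%:C)) ?ltcR//.
    exact: HN.
  by case: e e0 {e0' HN} => a b; rewrite ltcE /= => /andP[/eqP-> _].
exists l => e e0; move/cvgrPdist_lt : ul => /(_ e%:C).
rewrite ltcR => /(_ e0)[N _ HN]; exists N => n Nn.
by have := HN n Nn; rewrite /= rnormE ltcR.
Qed.

Lemma geometric_lt (C q e : R) : 0 <= q < 1 -> 0 < e ->
  exists N, forall n, (N <= n)%N -> C * q ^+ n < e.
Proof.
move=> /andP[q0 q1] e0.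
have := @cvg_geometric R C q; rewrite ger0_norm// => /(_ q1) /cvgrPdist_lt.
move=> /(_ e e0)[N _ HN]; exists N => n Nn; have := HN n Nn.
by rewrite /= sub0r normrN; apply: le_lt_trans; rewrite ler_norm.
Qed.

(** The contraction principle, for a complete normed module over [R[i]] and a
    map that is contracting only on a closed invariant set. *)
Lemma fixed_point (V : completeNormedModType R[i]) (U : set V) (T : V -> V)
    (q : R) (x0 : V) :
    closed U -> U x0 -> 0 <= q < 1 -> (forall x, U x -> U (T x)) ->
    (forall x y, U x -> U y -> rnorm (T x - T y) <= q * rnorm (x - y)) ->
  exists2 x, U x & T x = x.
Proof.
move=> clU Ux0 q01 TU Tq; have /andP[q0 q1] := q01.
have q1' : 0 < 1 - q by rewrite subr_gt0.
pose u n := iter n T x0.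
have Uu n : U (u n) by elim: n => // n; exact: TU.
pose D := rnorm (u 1%N - u 0%N).
have uS n : rnorm (u n.+1 - u n) <= q ^+ n * D.
  elim: n => [|n IH]; first by rewrite expr0 mul1r.
  rewrite (le_trans (Tq _ _ (Uu n.+1) (Uu n)))// exprS -mulrA.
  exact: ler_wpM2l.
have uD n m : rnorm (u (n + m)%N - u n) <= D / (1 - q) * q ^+ n.
  have {1}-> : D / (1 - q) * q ^+ n = q ^+ n * D / (1 - q) by ring.
  rewrite ler_pdivlMr//.
  suff: rnorm (u (n + m)%N - u n) * (1 - q) <= q ^+ n * D * (1 - q ^+ m).
    move/le_trans; apply; rewrite ler_piMr ?mulr_ge0 ?exprn_ge0 ?rnorm_ge0//.
    by rewrite gerBl exprn_ge0.
  elim: m => [|m IH]; first by rewrite addn0 subrr rnorm0 mul0r subrr mulr0.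
  have -> : u (n + m.+1)%N - u n = (u (n + m).+1 - u (n + m)%N) +
    (u (n + m)%N - u n) by rewrite addrA subrK addnS.
  apply: (@le_trans _ _ ((q ^+ (n + m) * D + rnorm (u (n + m)%N - u n))
     * (1 - q))).
    rewrite ler_pM2r//; apply: (le_trans (rnormD _ _)); rewrite lerD2r.
    exact: uS.
  rewrite mulrDl; apply: (le_trans (lerD (lexx _) IH)).
  rewrite le_eqVlt; apply/orP; left; apply/eqP.
  by rewrite exprD exprS; ring.
have [|l ul] := @rcauchy_cvg V u.
  move=> e e0; have [|N HN] := @geometric_lt (D / (1 - q)) q (e / 2) q01.
    by rewrite divr_gt0.
  exists N => m n Nm Nn.
  have H k : (N <= k)%N -> rnorm (u k - u N) < e / 2.
    by move=> Nk; rewrite -(subnKC Nk) (le_lt_trans (uD _ _))// HN.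
  have -> : u m - u n = (u m - u N) + (u N - u n) by rewrite addrA subrK.
  rewrite (le_lt_trans (rnormD _ _))// [ltRHS]splitr ltrD ?H//.
  by rewrite rnormB H.
have Ul : U l.
  apply: (closed_seq_limit clU) => e /ul[N HN].
  by exists (u N); [exact: Uu|exact: HN].
exists l => //; apply/eqP; rewrite -subr_eq0; apply/eqP/rnorm_eq0/le_anti.
rewrite rnorm_ge0 andbT; apply/ler_addgt0Pl => e e0; rewrite addr0.
have [|N HN] := ul (e / 2); first by rewrite divr_gt0.
have -> : T l - l = (T l - u N.+1) + (u N.+1 - l) by rewrite addrA subrK.
rewrite (le_trans (rnormD _ _))// [leRHS]splitr lerD//.
  rewrite (le_trans (Tq _ _ Ul (Uu N)))//.
  rewrite (le_trans (y := rnorm (l - u N)))//.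
    by rewrite ler_piMl ?rnorm_ge0// ltW.
  exact/ltW/HN.
by rewrite rnormB ltW// HN.
Qed.

End sequences.

(** * Elementary algebra in a C*-algebra *)

Section cstar_basics.
Variables (R : realType) (A : cstarAlgType R).
Implicit Types x y : A.

Lemma cmul0l x : 0 ** x = 0.
Proof. by have := cmulZl 0 0 x; rewrite !scale0r. Qed.

Lemma cmul0r x : x ** 0 = 0.
Proof. by have := cmulZr 0 x 0; rewrite !scale0r. Qed.

Lemma cmulNl x y : (- x) ** y = - (x ** y).
Proof. by rewrite -scaleN1r cmulZl scaleN1r. Qed.

Lemma cmulNr x y : x ** (- y) = - (x ** y).
Proof. by rewrite -scaleN1r cmulZr scaleN1r. Qed.

Lemma cmulBl x y (z : A) : (x - y) ** z = x ** z - y ** z.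
Proof. by rewrite cmulDl cmulNl. Qed.

Lemma cmulBr x y (z : A) : x ** (y - z) = x ** y - x ** z.
Proof. by rewrite cmulDr cmulNr. Qed.

Lemma cstar0 : (0 : A)^** = 0.
Proof. by have := cstarZ 0 (0 : A); rewrite !scale0r rmorph0 scale0r. Qed.

Lemma cstarN x : (- x)^** = - x^**.
Proof. by rewrite -scaleN1r cstarZ rmorphN1 scaleN1r. Qed.

Lemma cstarB x y : (x - y)^** = x^** - y^**.
Proof. by rewrite cstarD cstarN. Qed.

Lemma cmul_suml (I : Type) (r : seq I) (P : pred I) (F : I -> A) x :
  (\sum_(i <- r | P i) F i) ** x = \sum_(i <- r | P i) F i ** x.
Proof.
by elim/big_rec2: _ => [|i y z _ <-]; rewrite ?cmul0l// cmulDl.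
Qed.

Lemma cmul_sumr (I : Type) (r : seq I) (P : pred I) (F : I -> A) x :
  x ** (\sum_(i <- r | P i) F i) = \sum_(i <- r | P i) x ** F i.
Proof.
by elim/big_rec2: _ => [|i y z _ <-]; rewrite ?cmul0r// cmulDr.
Qed.

Lemma cstar_sum (I : Type) (r : seq I) (P : pred I) (F : I -> A) :
  (\sum_(i <- r | P i) F i)^** = \sum_(i <- r | P i) (F i)^**.
Proof.
by elim/big_rec2: _ => [|i y z _ <-]; rewrite ?cstar0// cstarD.
Qed.

Lemma rnormM x y : rnorm (x ** y) <= rnorm x * rnorm y.
Proof. by rewrite -lecR rmorphM /= -!rnormE cnormM. Qed.

Lemma rnorm_star x : rnorm (x^** ** x) = rnorm x ^+ 2.
Proof. by apply: complexI; rewrite rmorphXn /= -!rnormE cnorm_star. Qed.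

(** From [`|x| ^ 2 = `|x^** x| <= `|x^**| `|x|] one gets one inequality, and the
    other one by exchanging [x] and its adjoint. *)
Lemma rnorm_cstar x : rnorm x^** = rnorm x.
Proof.
have H y : rnorm y <= rnorm y^**.
  have [y0|y0] := leP (rnorm y) 0; first exact: le_trans y0 (rnorm_ge0 _).
  by rewrite -(ler_pM2r y0) -expr2 -rnorm_star rnormM.
by apply/le_anti; rewrite H -{2}(cstarK x) H.
Qed.

End cstar_basics.

(** * Automatic continuity of star-homomorphisms *)

Section automatic_continuity.
Variable R : realType.
Implicit Types A B : cstarAlgType R.

Section starhom_lemmas.
Variables (A B : cstarAlgType R) (f : A -> B) (hf : starhom f).

Lemma starhomD x y : f (x + y) = f x + f y.
Proof. by case: hf => fl _ _; have := fl 1 x y; rewrite !scale1r. Qed.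

Lemma starhom0 : f 0 = 0.
Proof. by apply: (@addrI _ (f 0)); rewrite -starhomD !addr0. Qed.

Lemma starhomZ a x : f (a *: x) = a *: f x.
Proof.
by case: hf => fl _ _; have := fl a x 0; rewrite !addr0 starhom0 addr0.
Qed.

Lemma starhomB x y : f (x - y) = f x - f y.
Proof. by rewrite starhomD -scaleN1r starhomZ scaleN1r. Qed.

Lemma starhomM x y : f (x ** y) = f x ** f y.
Proof. by case: hf. Qed.

Lemma starhom_star x : f x^** = (f x)^**.
Proof. by case: hf. Qed.

Lemma starhom_sum (I : Type) (r : seq I) (P : pred I) (F : I -> A) :
  f (\sum_(i <- r | P i) F i) = \sum_(i <- r | P i) f (F i).
Proof.
by elim/big_rec2: _ => [|i y z _ <-]; rewrite ?starhom0// starhomD.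
Qed.

End starhom_lemmas.

(** The hypothesis says that [1 + w] is an isometry, in an algebra that need
    not contain [1]; hence left multiplication by [1 + w] preserves norms. *)
Lemma quasi_unitary_isometry B (w x : B) :
  w + w^** + w^** ** w = 0 -> rnorm (x + w ** x) = rnorm x.
Proof.
move=> w0; apply/eqP; rewrite -(eqrXn2 (_ : 0 < 2)%N) ?rnorm_ge0//; apply/eqP.
rewrite -!rnorm_star; congr rnorm.
rewrite cstarD cstarM !cmulDl !cmulDr !cmulA -!addrA.
rewrite -[RHS]addr0; congr (_ + _).
rewrite -[x^** ** w^** ** w]cmulA -!cmulDl -!cmulDr addrA w0.
by rewrite cmul0r cmul0l.
Qed.

(** The equation for [g] is [(1 - g) ^ 2 = 1 - h ^ 2], written without unit.
    The solution is the fixed point of [g |-> (h ^ 2 + g ^ 2) / 2], which is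
    contracting with ratio [q = `|h|] on the ball of radius [q] because
    [x ^ 2 - y ^ 2 = x (x - y) + (x - y) y].  Self-adjointness and commutation
    with [h] are closed conditions preserved by the iteration. *)
Lemma half_root A (h : A) : h^** = h -> rnorm h < 1 ->
  exists g : A, [/\ g^** = g, g ** h = h ** g & g + g = h ** h + g ** g].
Proof.
move=> hh h1; set q := rnorm h.
have q0 : 0 <= q by exact: rnorm_ge0.
pose U := [set g : A | rnorm g <= q] `&` [set g | g^** - g = 0]
  `&` [set g | g ** h - h ** g = 0].
pose T g : A := (2^-1)%:C *: (h ** h + g ** g).
have n2 : `|2^-1 : R| = 2^-1 by rewrite ger0_norm// invr_ge0.
have [|||||g [[/= _ gs] gc] Tg] := @fixed_point R A U T q 0.
- apply: closedI; first apply: closedI.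
  + exact: closed_rnorm_le.
  + apply: (@closed_zeros _ _ _ (fun g : A => g^** - g) 2) => [x y|x].
      rewrite cstarB !opprB addrACA [RHS]addrACA; congr (_ + _).
      by rewrite addrC.
    rewrite (le_trans (rnormD _ _))// rnormN rnorm_cstar mulr_natl mulr2n//.
  + apply: (@closed_zeros _ _ _ (fun g : A => g ** h - h ** g) (2 * q))
      => [x y|x].
      rewrite cmulBl cmulBr !opprB addrACA [RHS]addrACA; congr (_ + _).
      by rewrite addrC.
    rewrite (le_trans (rnormD _ _))// rnormN.
    rewrite -mulrA mulr_natl mulr2n lerD// ?rnormM//.
    by rewrite (le_trans (rnormM _ _))// mulrC.
- by rewrite /U /= rnorm0 cstar0 cmul0l cmul0r subr0.
- by rewrite q0.
- move=> x [[/= xq /eqP]]; rewrite subr_eq0 => /eqP xs /eqP.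
  rewrite subr_eq0 => /eqP xh.
  split; first split=> /=.
  + rewrite /T rnormZr n2 ler_pdivrMl//.
    rewrite (le_trans (rnormD _ _))// mulr_natl mulr2n lerD//.
      by rewrite (le_trans (rnormM _ _))// ler_piMr// ltW.
    by rewrite (le_trans (rnormM _ _))// -[leRHS]mulr1 ler_pM ?rnorm_ge0//
      (le_trans xq)// ltW.
  + by rewrite /T cstarZ conjc_real cstarD !cstarM hh xs subrr.
  + rewrite /T /= cmulZl cmulZr cmulDl cmulDr -!cmulA xh.
    by rewrite [x ** (h ** x)]cmulA xh -cmulA subrr.
- move=> x y [[/= xq _] _] [[/= yq _] _].
  rewrite /T -scalerBr rnormZr n2 ler_pdivrMl// mulrA.
  have -> : h ** h + x ** x - (h ** h + y ** y) = x ** (x - y) + (x - y) ** y.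
    rewrite opprD addrACA subrr add0r cmulBr cmulBl.
    by rewrite addrA subrK.
  rewrite (le_trans (rnormD _ _))// mulr_natl mulr2n mulrDl lerD//.
    by rewrite (le_trans (rnormM _ _))// ler_wpM2r ?rnorm_ge0.
  by rewrite (le_trans (rnormM _ _))// mulrC ler_wpM2r ?rnorm_ge0.
exists g; split.
- by move/eqP: gs; rewrite subr_eq0 => /eqP.
- by move/eqP: gc; rewrite subr_eq0 => /eqP.
- rewrite -{1 2}Tg /T -scalerDl -rmorphD /=.
  have -> : 2^-1 + 2^-1 = 1 :> R by lra.
  by rewrite scale1r.
Qed.

(** With [b = f h] and [d = f g], where [g] is given by [half_root], the
    elements [1 - d + i b] and [1 - d - i b] are formally unitary, and their
    difference is [2 i b].  Left multiplication by each of them is isometric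
    on [B], so that [2 `|b x| <= 2 `|x|]; the choice [x = b] gives [`|b| <= 1].
    Only algebraic identities are carried from [A] to [B], which is why no
    continuity of [f] enters. *)
Lemma starhom_selfadjoint_le1 A B (f : A -> B) (h : A) : starhom f ->
  h^** = h -> rnorm h < 1 -> rnorm (f h) <= 1.
Proof.
move=> hf hh h1; have [g [gs gh g2]] := half_root hh h1.
set b := f h; set d := f g.
have bs : b^** = b by rewrite /b -(starhom_star hf) hh.
have ds : d^** = d by rewrite /d -(starhom_star hf) gs.
have bd : d ** b = b ** d by rewrite /b /d -!(starhomM hf) gh.
have b2 : d + d = b ** b + d ** d.
  by rewrite /b /d -!(starhomM hf) -!(starhomD hf) g2.
pose w (c : R[i]) := c *: b - d.
have wu c : conjc c = - c -> c * c = -1 ->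
    forall x, rnorm (x + w c ** x) = rnorm x.
  move=> cs cc x; apply: quasi_unitary_isometry.
  rewrite /w cstarB cstarZ bs ds cs cmulBl !cmulBr !cmulZl !cmulZr scalerA.
  rewrite mulNr cc opprK scale1r bd scaleNr !opprD !opprK.
  rewrite [X in X + _]addrACA subrr add0r -opprD b2.
  by rewrite scaleNr opprK [X in _ + X]addrA addrK addNr.
pose j : R[i] := 0 +i* 1.
have jc : conjc j = - j by rewrite /j /= ; congr (_ +i* _); rewrite oppr0.
have jj : j * j = -1 by rewrite -expr2 sqr_i.
have jN : conjc (- j) = - - j.
  by rewrite /j; apply/eqP; rewrite eq_complex /= !oppr0 !eqxx.
have jjN : - j * - j = -1 by rewrite mulrNN.
have e : (b + w j ** b) - (b + w (- j) ** b) = (2%:C * j) *: (b ** b).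
  rewrite opprD addrACA subrr add0r -cmulBl /w opprB addrA subrK.
  by rewrite scaleNr opprK -scalerDl cmulZl [2%:C]rmorph_nat mulr_natl mulr2n.
(* [rnormZ] needs the modulus of the scalar [2 i] *)
have n2j : complex.Re `|2%:C * j| = 2.
  rewrite normc_def /= !mulr0 !mul0r !mulr1 subrr expr0n !add0r addr0.
  by rewrite sqrtr_sqr ger0_norm.
have b0 := rnorm_ge0 b.
have : rnorm (b + w j ** b - (b + w (- j) ** b)) <= rnorm b + rnorm b.
  by rewrite (le_trans (rnormD _ _))// rnormN !wu.
rewrite e rnormZ n2j -{1}bs rnorm_star; nra.
Qed.

(** The self-adjoint case follows from the previous bound by scaling, and the
    general case from the self-adjoint element [x^** ** x], whose norm is the
    square of the norm of [x]. *)
Lemma starhom_contractive A B (f : A -> B) : starhom f ->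
  forall x, rnorm (f x) <= rnorm x.
Proof.
move=> hf.
have sa h : h^** = h -> rnorm (f h) <= rnorm h.
  move=> hh; apply/ler_addgt0Pr => e e0; set t := rnorm h + e.
  have t0 : 0 < t by rewrite ltr_wpDl ?rnorm_ge0.
  have ti0 : 0 <= t^-1 by rewrite invr_ge0 ltW.
  have := @starhom_selfadjoint_le1 _ _ f ((t^-1)%:C *: h) hf.
  rewrite cstarZ conjc_real hh => /(_ erefl).
  rewrite (starhomZ hf) !rnormZr ger0_norm// ![t^-1 * _]mulrC.
  by rewrite ltr_pdivrMr// ler_pdivrMr// mul1r; apply; rewrite ltrDl.
move=> x; rewrite -(ler_pXn2r (_ : 0 < 2)%N) ?nnegrE ?rnorm_ge0//.
rewrite -!rnorm_star -(starhom_star hf) -(starhomM hf); apply: sa.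
by rewrite cstarM cstarK.
Qed.

Lemma generated_by_eq A (X : set A) (S : set A) :
  generated_by X -> closed_star_subalgebra S -> X `<=` S -> forall x, S x.
Proof. by move=> gX cS XS x; rewrite (gX S cS XS). Qed.

(** The equalizer of two star-homomorphisms is closed since both are
    contractive, so it is a closed star-subalgebra. *)
Lemma starhom_ext A B (X : set A) (f g : A -> B) : generated_by X ->
  starhom f -> starhom g -> {in X, f =1 g} -> f =1 g.
Proof.
move=> gX hf hg fg.
suff: forall x, [set x | f x - g x = 0] x.
  by move=> H x; apply/eqP; rewrite -subr_eq0; apply/eqP/H.
apply: (generated_by_eq gX) => [|x Xx /=]; last first.
  by rewrite fg ?subrr// inE.
have E x : f x - g x = 0 <-> f x = g x.
  by split=> [/eqP|->]; [rewrite subr_eq0 => /eqP|rewrite subrr].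
split=> /=.
- by rewrite (starhom0 hf) (starhom0 hg) subrr.
- move=> a x y /E fx /E fy; apply/E.
  by rewrite (starhomD hf) (starhomD hg) (starhomZ hf) (starhomZ hg) fx fy.
- by move=> x y /E fx /E fy; apply/E; rewrite !starhomM// fx fy.
- by move=> x /E fx; apply/E; rewrite !starhom_star// fx.
- apply: (@closed_zeros _ _ _ (fun x => f x - g x) 2) => [x y|x].
    by rewrite (starhomB hf) (starhomB hg) !opprD addrACA.
  rewrite (le_trans (rnormD _ _))// rnormN mulr_natl mulr2n.
  by rewrite lerD// starhom_contractive.
Qed.

Lemma is_unit_uniq A (u u' : A) : is_unit u -> is_unit u' -> u = u'.
Proof. by move=> hu hu'; have [<- _] := hu' u; have [_ ->] := hu u'. Qed.

Lemma generated_unit A (X : set A) (u : A) : generated_by X -> u^** = u ->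
  (forall x, X x -> u ** x = x) -> (forall x, X x -> x ** u = x) -> is_unit u.
Proof.
move=> gX us uX Xu x.
apply: (generated_by_eq (S := [set x | u ** x = x /\ x ** u = x]) gX);
  last first.
  by move=> y Xy; split; [exact: uX|exact: Xu].
have E (f g : A -> A) y : f y - g y = 0 <-> f y = g y.
  by split=> [/eqP|->]; [rewrite subr_eq0 => /eqP|rewrite subrr].
split=> /=.
- by rewrite cmul0l cmul0r.
- move=> a y z [uy yu] [uz zu].
  by rewrite cmulDl cmulDr cmulZl cmulZr uy yu uz zu.
- by move=> y z [uy yu] [uz zu]; rewrite cmulA uy -cmulA zu.
- by move=> y [uy yu]; split; rewrite -[in LHS]us -cstarM ?uy ?yu.
- rewrite (_ : mkset _ = [set y | u ** y - y = 0] `&` [set y | y ** u - y = 0]).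
    apply: closedI.
      apply: (@closed_zeros _ _ _ (fun y : A => u ** y - y) (rnorm u + 1))
        => [y z|y].
        by rewrite cmulBr !opprD addrACA.
      rewrite (le_trans (rnormD _ _))// rnormN mulrDl mul1r lerD2r.
      exact: rnormM.
    apply: (@closed_zeros _ _ _ (fun y : A => y ** u - y) (rnorm u + 1))
      => [y z|y].
      by rewrite cmulBl !opprD addrACA.
    rewrite (le_trans (rnormD _ _))// rnormN mulrDl mul1r lerD2r mulrC.
    exact: rnormM.
  apply/seteqP; split=> y /=.
    by move=> [-> ->]; rewrite subrr.
  by move=> [/E + /E].
Qed.

End automatic_continuity.

(** * The Hilbert space of square-summable sequences *)

Section dot.
Variable R : realType.
Implicit Types z w a : R[i].

(** The scalar product of the real plane.  Working with the real part of the
    Hermitian product keeps all analysis over [R]: a complex linear operator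
    has the same adjoint for both, as [ip (a *: x) y = ip x (conjc a *: y)]. *)
Definition dot z w : R :=
  complex.Re z * complex.Re w + complex.Im z * complex.Im w.

Lemma dotC z w : dot z w = dot w z.
Proof. by rewrite /dot; ring. Qed.

Lemma dotDl z z' w : dot (z + z') w = dot z w + dot z' w.
Proof. by case: z z' w => [a b] [c d] [e f]; rewrite /dot /=; ring. Qed.

Lemma dotZ a z w : dot (a * z) w = dot z (conjc a * w).
Proof. by case: a z w => [a b] [c d] [e f]; rewrite /dot /=; ring. Qed.

Lemma dotZr (r : R) z w : dot (r%:C * z) w = r * dot z w.
Proof. by case: z w => [c d] [e f]; rewrite /dot /=; ring. Qed.

Lemma dotzz_ge0 z : 0 <= dot z z.
Proof. by rewrite /dot -!expr2 addr_ge0 ?sqr_ge0. Qed.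

Lemma dotzz_eq0 z : dot z z = 0 -> z = 0.
Proof.
case: z => a b; rewrite /dot /= -!expr2 => /eqP.
by rewrite paddr_eq0 ?sqr_ge0// !sqrf_eq0 => /andP[/eqP-> /eqP->].
Qed.

Lemma dotDD z w : dot (z + w) (z + w) = dot z z + 2 * dot z w + dot w w.
Proof. by case: z w => [a b] [c d]; rewrite /dot /=; ring. Qed.

Lemma dotDD_le z w : dot (z + w) (z + w) <= 2 * dot z z + 2 * dot w w.
Proof.
have := dotzz_ge0 (z - w).
by case: z w => [a b] [c d]; rewrite /dot /=; lra.
Qed.

Lemma dotZZ a z : dot (a * z) (a * z) = dot a a * dot z z.
Proof. by case: a z => [a b] [c d]; rewrite /dot /=; ring. Qed.

Lemma dotaa a : dot a a = complex.Re `|a| ^+ 2.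
Proof.
rewrite normc_def /= sqr_sqrtr ?addr_ge0 ?sqr_ge0//.
Qed.

End dot.

Section ell2.
Variable R : realType.
Implicit Types f g : nat -> R[i].

Definition ip_part f g n : R := \sum_(0 <= i < n) dot (f i) (g i).

Definition square_summable : {pred (nat -> R[i])} :=
  [pred f | `[< exists M, forall n, ip_part f f n <= M >]].

Lemma square_summable_submod : submod_closed square_summable.
Proof.
split=> [|a f g].
  apply/asboolP; exists 0 => n; rewrite /ip_part big1// => i _.
  by rewrite /dot /= mulr0 addr0.
move=> /asboolP[M fM] /asboolP[N gN]; apply/asboolP.
exists (2 * (dot a a * M) + 2 * N) => n.
apply: (@le_trans _ _ (2 * (dot a a * ip_part f f n) + 2 * ip_part g g n)).
  rewrite /ip_part !mulr_sumr -big_split /=; apply: ler_sum => i _.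
  rewrite -dotZZ; exact: dotDD_le.
by rewrite lerD// ler_pM2l// ler_wpM2l ?dotzz_ge0.
Qed.

HB.instance Definition _ := GRing.isSubmodClosed.Build R[i] (nat -> R[i])
  square_summable square_summable_submod.

Record ell2 := Ell2 { ell2_fun :> nat -> R[i];
  ell2P : ell2_fun \in square_summable }.

HB.instance Definition _ := [isSub for ell2_fun].
HB.instance Definition _ := [Choice of ell2 by <:].
HB.instance Definition _ := [SubChoice_isSubLmodule of ell2 by <:].

Implicit Types x y z : ell2.

Lemma ell2_eqP x y : x = y <-> x =1 y.
Proof. by split=> [->//|xy]; apply/val_inj/funext. Qed.

Lemma ell2D x y i : (x + y) i = x i + y i. Proof. by []. Qed.
Lemma ell2N x i : (- x) i = - x i. Proof. by []. Qed.
Lemma ell2Z a x i : (a *: x) i = a * x i. Proof. by []. Qed.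
Lemma ell20 i : (0 : ell2) i = 0. Proof. by []. Qed.

Definition ip x y : R := limn (ip_part x y).

Lemma ip_part_nondec f : nondecreasing_seq (ip_part f f).
Proof.
apply/nondecreasing_seqP => n; rewrite /ip_part big_nat_recr//= lerDl.
exact: dotzz_ge0.
Qed.

Lemma ip_part_cvg_self x : cvgn (ip_part x x).
Proof.
have /asboolP[M xM] := ell2P x.
apply: nondecreasing_is_cvgn; first exact: ip_part_nondec.
by exists M => _ [n _ <-].
Qed.

(** Polarization reduces the convergence of the series to that of series of
    nonnegative terms with bounded partial sums. *)
Lemma ip_part_cvg x y : cvgn (ip_part x y).
Proof.
have -> : ip_part x y = (fun n => 2^-1 *: (ip_part (x + y) (x + y) n
    - ip_part x x n - ip_part y y n)).
  apply/funext => n; rewrite /ip_part -!sumrB scaler_sumr.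
  apply: eq_bigr => i _; rewrite ell2D dotDD /GRing.scale /=.
  lra.
apply: is_cvgZr; apply: is_cvgB; last exact: ip_part_cvg_self.
by apply: is_cvgB; exact: ip_part_cvg_self.
Qed.

Lemma ip_cvg x y : ip_part x y @ \oo --> ip x y.
Proof. exact: ip_part_cvg. Qed.

Lemma ip_unique x y l : ip_part x y @ \oo --> l -> ip x y = l.
Proof. by move=> xyl; apply: cvg_lim. Qed.

Lemma ip_eq (x y x' y' : ell2) :
  (forall i, dot (x i) (y i) = dot (x' i) (y' i)) -> ip x y = ip x' y'.
Proof.
move=> H; rewrite /ip; congr (limn _); apply/funext => n.
by apply: eq_bigr.
Qed.

Lemma ipC x y : ip x y = ip y x.
Proof. by apply: ip_eq => i; rewrite dotC. Qed.

Lemma ipDl x y z : ip (x + y) z = ip x z + ip y z.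
Proof.
apply: ip_unique.
have -> : ip_part (x + y) z = ip_part x z \+ ip_part y z.
  apply/funext => n; rewrite /ip_part /= -big_split /=; apply: eq_bigr => i _.
  exact: dotDl.
apply: cvgD; exact: ip_cvg.
Qed.

Lemma ipDr x y z : ip z (x + y) = ip z x + ip z y.
Proof. by rewrite ipC ipDl !(ipC z). Qed.

Lemma ipZ a x y : ip (a *: x) y = ip x (conjc a *: y).
Proof. by apply: ip_eq => i; rewrite !ell2Z dotZ. Qed.

Lemma ipZr (r : R) x y : ip (r%:C *: x) y = r * ip x y.
Proof.
apply: ip_unique.
have -> : ip_part (r%:C *: x) y = r \*: ip_part x y.
  apply/funext => n; rewrite /ip_part /= scaler_sumr; apply: eq_bigr => i _.
  exact: dotZr.
by apply: cvgZr; exact: ip_cvg.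
Qed.

Lemma ip_part_le x n : ip_part x x n <= ip x x.
Proof.
exact: nondecreasing_cvgn_le (@ip_part_nondec x) (@ip_part_cvg_self x) n.
Qed.

Lemma ip_le x M : (forall n, ip_part x x n <= M) -> ip x x <= M.
Proof.
move=> H; apply: limr_le; first exact: ip_part_cvg_self.
exact: nearW.
Qed.

Lemma ip_ge0 x : 0 <= ip x x.
Proof. by apply: le_trans (ip_part_le x 0); rewrite /ip_part big_geq. Qed.

Lemma dot_le_ip x i : dot (x i) (x i) <= ip x x.
Proof.
apply: le_trans (ip_part_le x i.+1).
rewrite /ip_part big_nat_recr//= lerDr sumr_ge0// => j _; exact: dotzz_ge0.
Qed.

Lemma ip_eq0 x : ip x x = 0 -> x = 0.
Proof.
move=> x0; apply/ell2_eqP => i; rewrite ell20; apply: dotzz_eq0.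
by apply/le_anti; rewrite dotzz_ge0 -x0 dot_le_ip.
Qed.

Lemma ip0r x : ip x 0 = 0.
Proof. by rewrite -(scale0r (0 : ell2)) ipC (ipZr 0) mul0r. Qed.

Lemma ipNr x y : ip x (- y) = - ip x y.
Proof. by apply/eqP; rewrite -addr_eq0 -ipDr addNr ip0r. Qed.

Lemma ipBr x y z : ip x (y - z) = ip x y - ip x z.
Proof. by rewrite ipDr ipNr. Qed.

Lemma ip_ext y z : (forall x, ip x y = ip x z) -> y = z.
Proof.
move=> H; apply/eqP; rewrite -subr_eq0; apply/eqP/ip_eq0.
by rewrite ipBr H subrr.
Qed.

Lemma ipDD x y : ip (x + y) (x + y) = ip x x + 2 * ip x y + ip y y.
Proof. by rewrite ipDl !ipDr (ipC y x); ring. Qed.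

Definition hnorm x : R := Num.sqrt (ip x x).

Lemma hnorm_ge0 x : 0 <= hnorm x. Proof. exact: sqrtr_ge0. Qed.

Lemma hnorm_sqr x : hnorm x ^+ 2 = ip x x.
Proof. by rewrite sqr_sqrtr ?ip_ge0. Qed.

Lemma hnorm_le x (M : R) : 0 <= M -> ip x x <= M ^+ 2 -> hnorm x <= M.
Proof.
move=> M0 H.
by rewrite -(ler_pXn2r (_ : 0 < 2)%N) ?nnegrE ?hnorm_ge0// hnorm_sqr.
Qed.

Lemma cauchy_schwarz x y : ip x y <= hnorm x * hnorm y.
Proof.
have quad t : 0 <= ip x x + 2 * t * ip x y + t ^+ 2 * ip y y.
  have := ip_ge0 (x + t%:C *: y).
  have ipZrr u w : ip u (t%:C *: w) = t * ip u w by rewrite ipC ipZr ipC.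
  rewrite ipDD !ipZrr ipZr; lra.
have [x0|x0] := eqVneq (ip x x) 0.
  by rewrite (ip_eq0 x0) ipC ip0r mulr_ge0 ?hnorm_ge0.
have x0' : 0 < ip x x by rewrite lt_def x0 ip_ge0.
have xp : 0 < hnorm x by rewrite /hnorm sqrtr_gt0.
have [y0|y0] := eqVneq (ip y y) 0.
  by rewrite (ip_eq0 y0) ip0r mulr_ge0 ?hnorm_ge0.
have y0' : 0 < ip y y by rewrite lt_def y0 ip_ge0.
have yp : 0 < hnorm y by rewrite /hnorm sqrtr_gt0.
(* at this value of [t] the two square terms are equal *)
have := quad (- (hnorm x / hnorm y)).
rewrite -!hnorm_sqr.
have -> : hnorm x ^+ 2 + 2 * - (hnorm x / hnorm y) * ip x y
    + (- (hnorm x / hnorm y)) ^+ 2 * hnorm y ^+ 2 =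
    (hnorm x * hnorm y - ip x y) * (2 * (hnorm x / hnorm y)).
  by field; rewrite gt_eqF.
by rewrite pmulr_lge0 ?subr_ge0// mulr_gt0// divr_gt0.
Qed.

Lemma hnormD x y : hnorm (x + y) <= hnorm x + hnorm y.
Proof.
apply: hnorm_le; first by rewrite addr_ge0 ?hnorm_ge0.
rewrite ipDD -!hnorm_sqr; have := cauchy_schwarz x y; nra.
Qed.

Lemma hnormZ a x : hnorm (a *: x) = complex.Re `|a| * hnorm x.
Proof.
have a0 : 0 <= complex.Re `|a| by rewrite normc_def sqrtr_ge0.
apply/eqP; rewrite -(eqrXn2 (_ : 0 < 2)%N) ?mulr_ge0 ?hnorm_ge0//.
rewrite exprMn !hnorm_sqr ipZ scalerA ipC.
have -> : conjc a * a = (complex.Re `|a| ^+ 2)%:C.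
  rewrite -dotaa /dot; case: a {a0} => u w; apply/eqP.
  by rewrite eq_complex /=; apply/andP; split; apply/eqP; ring.
by rewrite ipZr.
Qed.

Let normD x y : (hnorm (x + y))%:C <= (hnorm x)%:C + (hnorm y)%:C.
Proof. by rewrite -rmorphD /= lecR hnormD. Qed.

Let normZ a x : (hnorm (a *: x))%:C = `|a| * (hnorm x)%:C.
Proof.
rewrite hnormZ rmorphM; congr (_ * _).
Qed.

Let norm_eq0 x : (hnorm x)%:C = 0 -> x = 0.
Proof.
move=> /complexI h; apply: ip_eq0; by rewrite -hnorm_sqr h expr0n.
Qed.

HB.instance Definition _ := @Lmodule_isNormed.Build R[i] ell2
  (fun x => (hnorm x)%:C) normD normZ norm_eq0.

Lemma rnorm_ell2 x : rnorm x = hnorm x. Proof. by []. Qed.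

Lemma ip_rnorm x : ip x x = rnorm x ^+ 2.
Proof. by rewrite rnorm_ell2 hnorm_sqr. Qed.

Lemma ip_le_rnorm x y : ip x y <= rnorm x * rnorm y.
Proof. exact: cauchy_schwarz. Qed.

(** The limit is taken coordinatewise.  The bound on [u m - u n] passes to the
    limit in [m] on each partial sum, which is a finite sum, and then to the
    whole series. *)
Lemma ell2_cauchy_cvg (u : nat -> ell2) :
  (forall e : R, 0 < e -> exists N, forall m n, (N <= m)%N -> (N <= n)%N ->
      rnorm (u m - u n) < e) ->
  exists l, forall e : R, 0 < e -> exists N, forall n, (N <= n)%N ->
      rnorm (l - u n) < e.
Proof.
move=> H.
have H' i : exists l : R[i], forall e : R, 0 < e -> exists N, forall n,
    (N <= n)%N -> rnorm (l - u n i) < e.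
  apply: rcauchy_cvg => e /H[N HN]; exists N => m n Nm Nn.
  apply: le_lt_trans (HN m n Nm Nn).
  rewrite -(ler_pXn2r (_ : 0 < 2)%N) ?nnegrE ?rnorm_ge0// -ip_rnorm.
  by rewrite -dotaa -ell2N -ell2D dot_le_ip.
have [x xu] := choice H'.
have cvgi (p : R[i] -> R) : (forall z w : R[i], p (z - w) = p z - p w) ->
    (forall z : R[i], `|p z| <= rnorm z) ->
    forall i, (fun n => p (u n i)) @ \oo --> p (x i).
  move=> pB pl i; apply/cvgrPdist_lt => e /(xu i)[N HN].
  exists N => // n Nn; rewrite /= -pB; exact: le_lt_trans (pl _) (HN n Nn).
have cRe i : (fun n => complex.Re (u n i)) @ \oo --> complex.Re (x i).
  apply: cvgi => [[a b] [c d]//|[a b]].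
  by rewrite /rnorm normc_def /= -sqrtr_sqr ler_wsqrtr// lerDl sqr_ge0.
have cIm i : (fun n => complex.Im (u n i)) @ \oo --> complex.Im (x i).
  apply: cvgi => [[a b] [c d]//|[a b]].
  by rewrite /rnorm normc_def /= -sqrtr_sqr ler_wsqrtr// lerDr sqr_ge0.
have lim (e : R) : 0 < e -> exists N, forall n K, (N <= n)%N ->
    ip_part (x - u n) (x - u n) K <= e ^+ 2.
  move=> e0; have [N HN] := H e e0; exists N => n K Nn.
  have c : (fun m => ip_part (u m - u n) (u m - u n) K) @ \oo -->
      ip_part (x - u n) (x - u n) K.
    rewrite /ip_part; elim: K => [|K IH].
      rewrite big_geq//; under eq_fun do rewrite big_geq//; exact: cvg_cst.
    rewrite big_nat_recr//=; under eq_fun do rewrite big_nat_recr//=.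
    apply: cvgD => //; rewrite /dot.
    have E1 : (fun m => complex.Re ((u m - u n) K)) @ \oo -->
        complex.Re ((x - u n :> (nat -> R[i])) K).
      rewrite /= raddfB /=; under eq_fun do rewrite raddfB /=.
      by apply: cvgB => //; exact: cvg_cst.
    have E2 : (fun m => complex.Im ((u m - u n) K)) @ \oo -->
        complex.Im ((x - u n :> (nat -> R[i])) K).
      rewrite /= raddfB /=; under eq_fun do rewrite raddfB /=.
      by apply: cvgB => //; exact: cvg_cst.
    by apply: cvgD; apply: cvgM.
  rewrite -(cvg_lim (@Rhausdorff R) c); apply: limr_le.
    by apply/cvg_ex; eexists; exact: c.
  exists N => // m Nm /=; apply: (le_trans (ip_part_le (u m - u n) K)).
  by rewrite ip_rnorm ler_pXn2r ?nnegrE ?rnorm_ge0 ?ltW// HN.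
have [N1 HN1] := lim 1 ltr01.
have dsum n : (N1 <= n)%N -> (x - u n :> (nat -> R[i])) \in square_summable.
  by move=> Nn; apply/asboolP; exists (1 ^+ 2) => K; apply: HN1.
have xsum : x \in square_summable.
  rewrite -(subrK (u N1 : nat -> R[i]) x); apply: rpredD; last exact: ell2P.
  exact: dsum.
exists (Ell2 xsum) => e e0; have e2 : 0 < e / 2 by rewrite divr_gt0.
have [N HN] := lim _ e2; exists N => n Nn.
have : rnorm (Ell2 xsum - u n) <= e / 2.
  by apply: hnorm_le; rewrite ?(ltW e2)//; apply: ip_le => K; apply: HN.
move/le_lt_trans; apply; lra.
Qed.

End ell2.

(** * Bounded operators on the space of square-summable sequences *)

(** Completeness is stated with Cauchy filters; in a normed module it suffices
    to treat sequences, by choosing centres of balls of radius [1 / (n + 1)]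
    that belong to the filter. *)
Lemma seq_complete (R : realType) (V : normedModType R[i]) :
    (forall u : nat -> V,
      (forall e : R, 0 < e -> exists N, forall m n, (N <= m)%N -> (N <= n)%N ->
          rnorm (u m - u n) < e) ->
      exists l, forall e : R, 0 < e -> exists N, forall n, (N <= n)%N ->
          rnorm (l - u n) < e) ->
  forall F : set_system V, ProperFilter F -> cauchy F -> cvg F.
Proof.
move=> H F FF /cauchyP Fc.
pose d n : R := n.+1%:R^-1.
have d0 n : 0 < d n by rewrite invr_gt0.
have dsmall (e : R) : 0 < e -> exists N, forall n, (N <= n)%N -> d n < e.
  move=> e0; exists (Num.truncn e^-1) => n Nn.
  rewrite /d -[ltRHS]invrK ltf_pV2 ?posrE ?invr_gt0//.
  by apply: (lt_le_trans (truncnS_gt _)); rewrite ler_nat.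
have Fd n : exists x, F (ball x (d n)%:C) by apply: Fc; rewrite ltcR.
have [u Fu] := choice Fd.
have bE (x y : V) (r : R) : ball x r%:C y -> rnorm (x - y) < r.
  by rewrite -ball_normE /= rnormE ltcR.
have [|l ul] := H u.
  move=> e e0; have [|N HN] := dsmall (e / 2); first by rewrite divr_gt0.
  exists N => m n Nm Nn.
  have [y [/bE ym /bE yn]] := filter_ex (filterI (Fu m) (Fu n)).
  have -> : u m - u n = (u m - y) - (u n - y) by rewrite opprB addrA subrK.
  rewrite (le_lt_trans (rnormD _ _))// rnormN.
  by have := HN m Nm; have := HN n Nn; lra.
apply/cvg_ex; exists l; apply/cvgrPdist_lt => e.
rewrite ltcE /= => /andP[/eqP eI e0].
have e2 : 0 < complex.Re e / 2 by rewrite divr_gt0.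
have [N1 HN1] := ul _ e2; have [N2 HN2] := dsmall _ e2.
pose n := maxn N1 N2.
apply: filterS (Fu n) => y /bE yn.
have -> : e = (complex.Re e)%:C by case: e eI {e0 e2 HN1 HN2} => a b /= ->.
rewrite rnormE ltcR.
have -> : l - y = (l - u n) + (u n - y) by rewrite addrA subrK.
rewrite (le_lt_trans (rnormD _ _))//.
have := HN1 n (leq_maxl _ _); have := HN2 n (leq_maxr _ _); lra.
Qed.

Section operators.
Variable R : realType.
Local Notation H := (ell2 R).

(** The existence of an adjoint, which the Riesz representation theorem would
    give, is made part of the definition.  The adjoint is a bare function here,
    as its linearity and boundedness follow ([adjoint_adjointable]). *)
Definition adjointable : {pred (H -> H)} := [pred T |
  `[< [/\ linear T, exists M : R, forall x, rnorm (T x) <= M * rnorm x &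
    exists S : H -> H, forall x y, ip (T x) y = ip x (S y)] >]].

Lemma adjointable_submod : submod_closed adjointable.
Proof.
split=> [|a T U].
  apply/asboolP; split=> [b x y|/=|].
  - by rewrite /= scaler0 addr0.
  - by exists 0 => x; rewrite rnorm0 mul0r.
  - by exists (fun=> 0) => x y; rewrite ip0r ipC ip0r.
move=> /asboolP[Tl [M TM] [T' TT']] /asboolP[Ul [N UN] [U' UU']].
apply/asboolP; split.
- move=> b x y.
  have E z : (a *: T + U : H -> H) z = a *: T z + U z by [].
  by rewrite !E Tl Ul !scalerDr !scalerA [b * a]mulrC addrACA.
- exists (complex.Re `|a| * M + N) => x.
  rewrite (le_trans (rnormD (a *: T x) (U x)))// rnormZ mulrDl lerD//.
  by rewrite -mulrA ler_wpM2l// normc_def sqrtr_ge0.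
- exists (fun y => conjc a *: T' y + U' y) => x y.
  rewrite [(_ + _) x]/(a *: T x + U x) ipDl ipDr UU'; congr (_ + _).
  have T0 : 0 = T 0.
    by apply: (@addrI _ (T 0)); have := Tl 1 0 0; rewrite !scale1r !addr0.
  have TZ : T (a *: x) = a *: T x by have := Tl a x 0; rewrite -T0 !addr0.
  by rewrite -TZ TT' ipZ.
Qed.

HB.instance Definition _ := GRing.isSubmodClosed.Build R[i] (H -> H)
  adjointable adjointable_submod.

Record bop := Bop { bop_fun :> H -> H; bopP : bop_fun \in adjointable }.

HB.instance Definition _ := [isSub for bop_fun].
HB.instance Definition _ := [Choice of bop by <:].
HB.instance Definition _ := [SubChoice_isSubLmodule of bop by <:].

Implicit Types S T U : bop.

Lemma bop_eqP S T : S = T <-> S =1 T.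
Proof. by split=> [->//|ST]; apply/val_inj/funext. Qed.

Lemma bopDE S T x : (S + T) x = S x + T x. Proof. by []. Qed.
Lemma bopNE S x : (- S) x = - S x. Proof. by []. Qed.
Lemma bopZE a S x : (a *: S) x = a *: S x. Proof. by []. Qed.
Lemma bop_linear T : linear T. Proof. by have /asboolP[] := bopP T. Qed.

Lemma bopD T x y : T (x + y) = T x + T y.
Proof. by have := bop_linear T 1 x y; rewrite !scale1r. Qed.

Lemma bop0 T : T 0 = 0.
Proof. by apply: (@addrI _ (T 0)); rewrite -bopD !addr0. Qed.

Lemma bopZ T a x : T (a *: x) = a *: T x.
Proof. by have := bop_linear T a x 0; rewrite !addr0 bop0 addr0. Qed.

Definition opnorm T : R :=
  inf [set M : R | 0 <= M /\ forall x, rnorm (T x) <= M * rnorm x].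

Lemma opnorm_has_inf T :
  has_inf [set M : R | 0 <= M /\ forall x, rnorm (T x) <= M * rnorm x].
Proof.
split; last by exists 0 => M [].
have /asboolP[_ [M TM] _] := bopP T; exists `|M|; split=> // x.
by rewrite (le_trans (TM x))// ler_wpM2r ?rnorm_ge0// ler_norm.
Qed.

Lemma opnorm_ge0 T : 0 <= opnorm T.
Proof. by apply: lb_le_inf => [|M []//]; case: (opnorm_has_inf T). Qed.

Lemma opnorm_le T M : 0 <= M -> (forall x, rnorm (T x) <= M * rnorm x) ->
  opnorm T <= M.
Proof.
by move=> M0 TM; apply: ge_inf; [case: (opnorm_has_inf T)|split].
Qed.

Lemma rnorm_bop T x : rnorm (T x) <= opnorm T * rnorm x.
Proof.
have [x0|x0] := leP (rnorm x) 0.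
  have /rnorm_eq0-> : rnorm x = 0 by apply/le_anti; rewrite x0 rnorm_ge0.
  by rewrite bop0 !rnorm0 mulr0.
rewrite -ler_pdivrMr//; apply: lb_le_inf; first by case: (opnorm_has_inf T).
by move=> M [_ TM]; rewrite ler_pdivrMr.
Qed.

Let normD S T : (opnorm (S + T))%:C <= (opnorm S)%:C + (opnorm T)%:C.
Proof.
rewrite -rmorphD /= lecR; apply: opnorm_le => [|x].
  by rewrite addr_ge0 ?opnorm_ge0.
by rewrite bopDE (le_trans (rnormD _ _))// mulrDl lerD// rnorm_bop.
Qed.

Let absC (a : R[i]) : 0 <= complex.Re `|a|.
Proof. by rewrite normc_def sqrtr_ge0. Qed.

Let absC_eq0 (a : R[i]) : a != 0 -> 0 < complex.Re `|a|.
Proof.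
rewrite -normr_gt0; case: (`|a|) => u w; by rewrite ltcE /= => /andP[].
Qed.

Let normZ_le (a : R[i]) T : opnorm (a *: T) <= complex.Re `|a| * opnorm T.
Proof.
apply: opnorm_le => [|x]; first by rewrite mulr_ge0 ?opnorm_ge0.
by rewrite bopZE rnormZ -mulrA ler_wpM2l// rnorm_bop.
Qed.

Let normZ (a : R[i]) T : (opnorm (a *: T))%:C = `|a| * (opnorm T)%:C.
Proof.
have -> : `|a| = (complex.Re `|a|)%:C.
  by apply/esym/RRe_real; rewrite normr_real.
rewrite -rmorphM; congr (_%:C); apply/le_anti; rewrite normZ_le andTb.
have [->|a0] := eqVneq a 0; first by rewrite normr0 mul0r opnorm_ge0.
rewrite mulrC -ler_pdivlMr ?absC_eq0//.
rewrite -{1}[T](scalerK a0) (le_trans (normZ_le _ _))// normfV mulrC.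
rewrite ler_wpM2l ?opnorm_ge0//.
have -> : `|a| = (complex.Re `|a|)%:C.
  by apply/esym/RRe_real; rewrite normr_real.
by rewrite -fmorphV.
Qed.

Let norm_eq0 T : (opnorm T)%:C = 0 -> T = 0.
Proof.
move=> /complexI T0; apply/bop_eqP => x; apply: rnorm_eq0.
apply/le_anti; rewrite rnorm_ge0 andbT.
by have := rnorm_bop T x; rewrite T0 mul0r.
Qed.

HB.instance Definition _ := @Lmodule_isNormed.Build R[i] bop
  (fun T => (opnorm T)%:C) normD normZ norm_eq0.

Lemma adjoint_exists T : exists S : H -> H, forall x y, ip (T x) y = ip x (S y).
Proof. by have /asboolP[] := bopP T. Qed.

Definition adjoint_fun T : H -> H := projT1 (cid (adjoint_exists T)).

Lemma adjoint_funP T x y : ip (T x) y = ip x (adjoint_fun T y).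
Proof. by rewrite /adjoint_fun; case: cid. Qed.

Lemma adjoint_fun_le T x : rnorm (adjoint_fun T x) <= opnorm T * rnorm x.
Proof.
set y := adjoint_fun T x.
have [y0|y0] := leP (rnorm y) 0.
  by rewrite (le_trans y0)// mulr_ge0 ?opnorm_ge0 ?rnorm_ge0.
rewrite -(ler_pM2r y0) -expr2 -ip_rnorm {2}/y -adjoint_funP.
rewrite (le_trans (ip_le_rnorm _ _))// mulrAC ler_wpM2r ?rnorm_ge0//.
exact: rnorm_bop.
Qed.

Lemma adjoint_adjointable T : adjoint_fun T \in adjointable.
Proof.
apply/asboolP; split.
- move=> a x y; apply: ip_ext => z.
  rewrite -adjoint_funP !ipDr -adjoint_funP; congr (_ + _).
  have E (u w : H) : ip u (a *: w) = ip (conjc a *: u) w by rewrite ipZ conjcK.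
  by rewrite !E -adjoint_funP bopZ.
- by exists (opnorm T); exact: adjoint_fun_le.
- by exists T => x y; rewrite ipC -adjoint_funP ipC.
Qed.

Definition adjoint T := Bop (adjoint_adjointable T).

Lemma adjointP T x y : ip (T x) y = ip x (adjoint T y).
Proof. exact: adjoint_funP. Qed.

Lemma adjoint_eq T S : (forall x y, ip (T x) y = ip x (S y)) -> adjoint T = S.
Proof.
by move=> TS; apply/bop_eqP => y; apply: ip_ext => x; rewrite -adjointP TS.
Qed.

Lemma adjointl T x y : ip x (T y) = ip (adjoint T x) y.
Proof. by rewrite ipC adjointP ipC. Qed.

Lemma adjointK : involutive adjoint.
Proof. by move=> T; apply: adjoint_eq => x y; rewrite adjointl. Qed.

Lemma opnorm_adjoint_le T : opnorm (adjoint T) <= opnorm T.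
Proof. by apply: opnorm_le; [exact: opnorm_ge0|exact: adjoint_fun_le]. Qed.

Lemma adjointD : {morph adjoint : S T / S + T}.
Proof.
move=> S T; apply: adjoint_eq => x y.
by rewrite !bopDE ipDl ipDr !adjointP.
Qed.

Lemma adjointZ (a : R[i]) T : adjoint (a *: T) = conjc a *: adjoint T.
Proof.
apply: adjoint_eq => x y; rewrite !bopZE ipZ.
by rewrite adjointP bopZ.
Qed.

Lemma comp_adjointable S T : S \o T \in adjointable.
Proof.
apply/asboolP; split.
- by move=> a x y; rewrite /= bopD bopZ bopD bopZ.
- exists (opnorm S * opnorm T) => x.
  rewrite (le_trans (rnorm_bop S _))// -mulrA ler_wpM2l ?opnorm_ge0//.
  exact: rnorm_bop.
- by exists (adjoint T \o adjoint S) => x y; rewrite /= !adjointP.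
Qed.

Definition bcomp S T := Bop (comp_adjointable S T).

(** The limit is taken pointwise.  As adjunction is isometric, the adjoints
    also converge pointwise, and their limit is an adjoint of the limit. *)
Lemma bop_complete (F : set_system bop) : ProperFilter F -> cauchy F -> cvg F.
Proof.
apply: seq_complete => u uC.
have uCx (w : nat -> bop) (x : H) :
    (forall m n, rnorm (w m - w n) <= rnorm (u m - u n)) ->
    exists l, forall e : R, 0 < e -> exists N, forall n, (N <= n)%N ->
          rnorm (l - w n x) < e.
  move=> wu; apply: ell2_cauchy_cvg => e e0.
  have x0 : 0 < rnorm x + 1 by rewrite ltr_wpDl ?rnorm_ge0.
  have [|N HN] := uC (e / (rnorm x + 1)); first by rewrite divr_gt0.
  exists N => m n Nm Nn.
  rewrite -bopNE -bopDE (le_lt_trans (rnorm_bop _ _))//.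
  have := HN m n Nm Nn; rewrite ltr_pdivlMr//; apply: le_lt_trans.
  apply: ler_pM; [exact: opnorm_ge0|exact: rnorm_ge0| |by rewrite lerDl].
  exact: wu.
have [T uT] := choice (fun x => uCx u x (fun m n => lexx _)).
have adjB S T' : adjoint (S - T') = adjoint S - adjoint T'.
  by rewrite adjointD -scaleN1r adjointZ rmorphN1 scaleN1r.
have /choice[S uS] : forall x : H, exists l : H, forall e : R, 0 < e ->
    exists N, forall n, (N <= n)%N -> rnorm (l - adjoint (u n) x) < e.
  move=> x; apply: (uCx (fun n => adjoint (u n))) => m n.
  by rewrite -adjB; exact: opnorm_adjoint_le.
have near_le (a : R) : (forall e, 0 < e -> a <= e) -> a <= 0.
  by move=> ae; apply/ler_addgt0Pl => e e0; rewrite addr0 ae.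
have Tlin : linear T.
  move=> a x y; apply/eqP; rewrite -subr_eq0; apply/eqP/rnorm_eq0/le_anti.
  rewrite rnorm_ge0 andbT; apply: near_le => e e0.
  pose c := complex.Re `|a|; have c0 : 0 <= c by exact: absC.
  (* there are three error terms, one of which is multiplied by [c] *)
have d0 : 0 < e / (c + 2) by rewrite divr_gt0// ltr_wpDl.
  have [N1 HN1] := uT (a *: x + y) _ d0.
  have [N2 HN2] := uT x _ d0; have [N3 HN3] := uT y _ d0.
  pose n := maxn N1 (maxn N2 N3).
  have n1 : (N1 <= n)%N by rewrite leq_maxl.
  have n2 : (N2 <= n)%N by rewrite leq_max leq_maxl orbT.
  have n3 : (N3 <= n)%N by rewrite leq_max leq_maxr orbT.
  have -> : T (a *: x + y) - (a *: T x + T y) =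
    (T (a *: x + y) - u n (a *: x + y))
     - (a *: (T x - u n x) + (T y - u n y)).
    rewrite bop_linear scalerBr [in RHS]addrACA -opprD opprB addrA.
    by rewrite subrK.
  rewrite (le_trans (rnormD _ _))// rnormN.
  apply: (@le_trans _ _ (e / (c + 2) + (c * (e / (c + 2)) + e / (c + 2)))).
    apply: lerD; first exact/ltW/HN1.
    rewrite (le_trans (rnormD _ _))// rnormZ lerD//; last exact/ltW/HN3.
    by rewrite ler_wpM2l// ltW// HN2.
  rewrite le_eqVlt; apply/orP; left; apply/eqP; field.
  by rewrite gt_eqF// ltr_wpDl.
have unif (e : R) : 0 < e -> exists N, forall n, (N <= n)%N ->
    forall x, rnorm (T x - u n x) <= e * rnorm x.
  move=> e0; have [N HN] := uC e e0; exists N => n Nn x.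
  apply/ler_addgt0Pl => d d0.
  have [N' HN'] := uT x d d0; pose m := maxn N N'.
  have -> : T x - u n x = (T x - u m x) + (u m - u n) x.
    by rewrite bopDE bopNE addrA subrK.
  rewrite (le_trans (rnormD _ _))// lerD//.
    by apply/ltW/HN'; rewrite leq_maxr.
  rewrite (le_trans (rnorm_bop _ _))// ler_wpM2r ?rnorm_ge0//.
  by apply/ltW/HN; rewrite ?leq_maxl.
have ipcvg (x y z : H) (w : nat -> H) : (forall e : R, 0 < e -> exists N,
    forall n, (N <= n)%N -> rnorm (x - w n) < e) ->
    (fun n => ip (w n) y) @ \oo --> ip x y.
  move=> wx; apply/cvgrPdist_lt => e e0.
  have y0 : 0 < rnorm y + 1 by rewrite ltr_wpDl ?rnorm_ge0.
  have [|N HN] := wx (e / (rnorm y + 1)); first by rewrite divr_gt0.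
  exists N => // n /HN; rewrite ltr_pdivlMr// => h /=.
  apply: le_lt_trans h.
  have E : ip x y - ip (w n) y = ip (x - w n) y by rewrite !(ipC _ y) ipBr.
  apply: (@le_trans _ _ (rnorm (x - w n) * rnorm y)).
    rewrite E ler_norml ip_le_rnorm andbT lerNl -ipNr.
    by rewrite (le_trans (ip_le_rnorm _ _))// rnormN.
  by rewrite ler_wpM2l ?rnorm_ge0// lerDl.
have Tadj : T \in adjointable.
  apply/asboolP; split=> //.
  - have [N HN] := unif 1 ltr01; exists (1 + opnorm (u N)) => x.
    rewrite -[T x](subrK (u N x)) (le_trans (rnormD _ _))// mulrDl lerD//.
      exact: HN.
    exact: rnorm_bop.
  - exists S => x y.
    have c1 := ipcvg (T x) y 0 (fun n => u n x) (uT x).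
    have c2 := ipcvg (S y) x 0 (fun n => adjoint (u n) y) (uS y).
    rewrite -(cvg_lim (@Rhausdorff R) c1) ipC -(cvg_lim (@Rhausdorff R) c2).
    by congr (limn _); apply/funext => n; rewrite adjointP ipC.
exists (Bop Tadj) => e e0.
have [|N HN] := unif (e / 2); first by rewrite divr_gt0.
exists N => n Nn; have : rnorm (Bop Tadj - u n) <= e / 2.
  by apply: opnorm_le => [|x]; [rewrite divr_ge0// ltW|exact: HN].
move/le_lt_trans; apply; lra.
Qed.

HB.instance Definition _ := Uniform_isComplete.Build bop bop_complete.

Lemma bcompE S T x : bcomp S T x = S (T x). Proof. by []. Qed.

Let mulA : associative bcomp.
Proof. by move=> S T U; apply/bop_eqP => x; rewrite !bcompE. Qed.

Let mulDl : left_distributive bcomp +%R.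
Proof. by move=> S T U; apply/bop_eqP => x; rewrite bopDE !bcompE bopDE. Qed.

Let mulDr : right_distributive bcomp +%R.
Proof.
by move=> S T U; apply/bop_eqP => x; rewrite bopDE !bcompE bopDE bopD.
Qed.

Let mulZl (a : R[i]) S T : bcomp (a *: S) T = a *: bcomp S T.
Proof. by apply/bop_eqP => x; rewrite bopZE !bcompE bopZE. Qed.

Let mulZr (a : R[i]) S T : bcomp S (a *: T) = a *: bcomp S T.
Proof. by apply/bop_eqP => x; rewrite bopZE !bcompE bopZE bopZ. Qed.

Let starM S T : adjoint (bcomp S T) = bcomp (adjoint T) (adjoint S).
Proof. by apply: adjoint_eq => x y; rewrite !bcompE !adjointP. Qed.

Let opnormM S T : opnorm (bcomp S T) <= opnorm S * opnorm T.
Proof.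
apply: opnorm_le => [|x]; first by rewrite mulr_ge0 ?opnorm_ge0.
rewrite (le_trans (rnorm_bop S _))// -mulrA ler_wpM2l ?opnorm_ge0//.
exact: rnorm_bop.
Qed.

Let normM S T : `|bcomp S T| <= `|S| * `|T|.
Proof. by rewrite !rnormE -rmorphM lecR opnormM. Qed.

(** The nontrivial inequality is the usual computation
    [`|T x| ^ 2 = <T x, T x> = <x, T^** T x> <= `|T^** T| `|x| ^ 2]. *)
Let norm_star T : `|bcomp (adjoint T) T| = `|T| ^+ 2.
Proof.
rewrite !rnormE -rmorphXn; congr (_%:C); apply/le_anti/andP; split.
  rewrite (le_trans (opnormM _ _))// expr2 ler_wpM2r ?opnorm_ge0//.
  exact: opnorm_adjoint_le.
set s := rnorm (bcomp _ _); have s0 : 0 <= s by exact: rnorm_ge0.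
suff h : opnorm T <= Num.sqrt s.
  rewrite -(sqr_sqrtr s0); apply: lerXn2r => //; rewrite nnegrE ?sqrtr_ge0//.
  exact: opnorm_ge0.
apply: opnorm_le => [|x]; first exact: sqrtr_ge0.
rewrite -(ler_pXn2r (_ : 0 < 2)%N) ?nnegrE ?mulr_ge0 ?sqrtr_ge0 ?rnorm_ge0//.
rewrite exprMn -ip_rnorm adjointP [Num.sqrt s ^+ 2]sqr_sqrtr//.
rewrite (le_trans (ip_le_rnorm _ _))// mulrC expr2 mulrA.
by rewrite ler_wpM2r ?rnorm_ge0// (rnorm_bop (bcomp (adjoint T) T)).
Qed.

HB.instance Definition _ := isCStarAlgebra.Build R bop
  mulA mulDl mulDr mulZl mulZr adjointK adjointD adjointZ starM normM norm_star.

End operators.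

(** * Partial shifts *)

Section partial_shift.
Variable R : realType.
Local Notation H := (ell2 R).

Definition pinjective (a : nat -> option nat) : Prop :=
  forall m m' k, a m = Some k -> a m' = Some k -> m = m'.

Definition pull (a : nat -> option nat) (f : nat -> R[i]) (m : nat) : R[i] :=
  oapp f 0 (a m).

(** By injectivity the partial sum on the left runs over distinct coordinates
    of [x], listed in [s]. *)
Lemma pull_part_le a (x : H) n : pinjective a ->
  ip_part (pull a x) (pull a x) n <= ip x x.
Proof.
move=> ai.
pose s := [seq odflt 0%N (a i) | i <- index_iota 0 n & isSome (a i)].
have us : uniq s.
  rewrite map_inj_in_uniq ?filter_uniq ?iota_uniq// => i j.
  rewrite !mem_filter => /andP[ai_ _] /andP[aj_ _].
  case Ei: (a i) ai_ => [k|]// _; case Ej : (a j) aj_ => [l|]//= _ kl.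
  by apply: ai Ei _; rewrite Ej kl.
pose K := (\max_(k <- s) k).+1.
have sK : {subset s <= index_iota 0 K}.
  by move=> k ks; rewrite mem_index_iota /= ltnS; exact: leq_bigmax_seq.
apply: le_trans (ip_part_le x K).
have -> : ip_part (pull a x) (pull a x) n = \sum_(k <- s) dot (x k) (x k).
  rewrite big_map big_filter big_mkcond /=; apply: eq_bigr => i _.
  by rewrite /pull; case: (a i) => //=; rewrite /dot /= mulr0 addr0.
rewrite /ip_part [leRHS](bigID (mem s)) /= ler_wpDr//.
  by rewrite sumr_ge0// => k _; exact: dotzz_ge0.
rewrite -[leRHS]big_filter le_eqVlt; apply/orP; left; apply/eqP/perm_big.
rewrite uniq_perm ?filter_uniq ?iota_uniq// => k.
by rewrite mem_filter /=; case ks: (k \in s) => //=; rewrite sK.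
Qed.

Lemma pull_summable a (x : H) : pinjective a -> pull a x \in @square_summable R.
Proof.
by move=> ai; apply/asboolP; exists (ip x x) => n; exact: pull_part_le.
Qed.

Lemma pullD a (x y : H) i : pull a (x + y) i = pull a x i + pull a y i.
Proof. by rewrite /pull; case: (a i) => //=; rewrite addr0. Qed.

Lemma pullZ a (c : R[i]) (x : H) i : pull a (c *: x) i = c * pull a x i.
Proof. by rewrite /pull; case: (a i) => //=; rewrite mulr0. Qed.

Definition mutually_inverse (a b : nat -> option nat) : Prop :=
  forall m k, a m = Some k <-> b k = Some m.

Lemma mutually_inverse_inj a b : mutually_inverse a b -> pinjective a.
Proof.
by move=> ab m m' k /ab bk /ab; rewrite bk => -[].
Qed.

Lemma mutually_inverse_sym a b : mutually_inverse a b -> mutually_inverse b a.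
Proof. by move=> ab m k; split=> /ab. Qed.

Section shift.
Variables (a b : nat -> option nat) (ab : mutually_inverse a b).

Definition hpull (x : H) : H :=
  Ell2 (pull_summable x (mutually_inverse_inj ab)).

Lemma hpullD x y : hpull (x + y) = hpull x + hpull y.
Proof. by apply/ell2_eqP => i; exact: pullD. Qed.

Lemma hpull_le x : ip (hpull x) (hpull x) <= ip x x.
Proof.
by apply: ip_le => n; apply: pull_part_le; exact: mutually_inverse_inj ab.
Qed.

End shift.

(** No series has to be rearranged: the shifts along [a] and [b] are both
    contractive, so that the shift along [a] is isometric on the vectors [z]
    fixed by the composite, and hence preserves their products by polarization.
    Replacing [x] and [y] by their parts [x'] and [y'], on which both shifts
    are defined, changes no term of the two series. *)
Lemma hpull_adjoint a b (ab : mutually_inverse a b) x y :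
  ip (hpull ab x) y = ip x (hpull (mutually_inverse_sym ab) y).
Proof.
set ba := mutually_inverse_sym ab.
pose x' := hpull ba (hpull ab x); pose y' := hpull ba y.
have ax : hpull ab x' = hpull ab x.
  apply/ell2_eqP => m; rewrite /= /pull; case am : (a m) => [k|]//=.
  by rewrite /pull; have /ab-> := am; rewrite /= /pull am.
have ay : hpull ba (hpull ab y') = y'.
  apply/ell2_eqP => k; rewrite /= /pull; case bk : (b k) => [m|]//=.
  by rewrite /pull; have /ab am := bk; rewrite am /= /pull bk.
have iso z : hpull ba (hpull ab z) = z -> ip (hpull ab z) (hpull ab z) = ip z z.
  move=> zE; apply/le_anti; rewrite hpull_le.
  by have := hpull_le ba (hpull ab z); rewrite zE.
have ay' : hpull ba (hpull ab x') = x' by rewrite ax.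
have polar : ip (hpull ab x') (hpull ab y') = ip x' y'.
  have D : hpull ba (hpull ab (x' + y')) = x' + y' by rewrite !hpullD ay' ay.
  have := iso _ D; rewrite hpullD !ipDD (iso _ ay') (iso _ ay).
  by move/addIr/addrI/(mulfI _); apply; rewrite pnatr_eq0.
have -> : ip (hpull ab x) y = ip (hpull ab x') (hpull ab y').
  rewrite ax; apply: ip_eq => m; rewrite /= /pull.
  case am : (a m) => [k|]/=; last by rewrite /dot /= !mul0r.
  by rewrite /pull; have /ab-> := am.
rewrite polar; apply: ip_eq => k; rewrite /= /pull.
case bk : (b k) => [m|]/=; last by rewrite /dot /= !mulr0.
by rewrite /pull; have /ab-> := bk.
Qed.

Lemma hpull_adjointable a b (ab : mutually_inverse a b) :
  hpull ab \in @adjointable R.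
Proof.
apply/asboolP; split.
- move=> c x y; apply/ell2_eqP => i.
  by rewrite ell2D ell2Z -[LHS]/(pull a (c *: x + y) i) pullD pullZ.
- exists 1 => x; rewrite mul1r; apply: hnorm_le; first exact: rnorm_ge0.
  by rewrite -ip_rnorm hpull_le.
- by exists (hpull (mutually_inverse_sym ab)) => x y; exact: hpull_adjoint.
Qed.

Definition pshift a b (ab : mutually_inverse a b) : bop R :=
  Bop (hpull_adjointable ab).

Lemma pshiftE a b (ab : mutually_inverse a b) (x : H) m :
  pshift ab x m = oapp x 0 (a m).
Proof. by []. Qed.

Lemma pshift_star a b (ab : mutually_inverse a b) :
  (pshift ab)^** = pshift (mutually_inverse_sym ab).
Proof. by apply: adjoint_eq => x y; exact: hpull_adjoint. Qed.

Lemma cmul_bopE (S T : bop R) x : (S ** T) x = S (T x). Proof. by []. Qed.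

Definition pid (Y : set nat) (m : nat) : option nat :=
  if `[< Y m >] then Some m else None.

Lemma pid_inverse Y : mutually_inverse (pid Y) (pid Y).
Proof.
move=> m k; rewrite /pid; split; case: asboolP => // Ym [<-];
  by case: asboolP.
Qed.

Definition coord_proj Y : bop R := pshift (@pid_inverse Y).

Lemma coord_projE Y (x : H) m :
  coord_proj Y x m = if `[< Y m >] then x m else 0.
Proof. by rewrite pshiftE /pid; case: asboolP. Qed.

Lemma coord_projP Y : projection (coord_proj Y).
Proof.
split.
  by rewrite pshift_star; apply/bop_eqP => x; apply/ell2_eqP => m.
apply/bop_eqP => x; apply/ell2_eqP => m.
by rewrite cmul_bopE !coord_projE; case: asboolP.
Qed.

Lemma coord_projM Y Z : coord_proj Y ** coord_proj Z = coord_proj (Y `&` Z).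
Proof.
apply/bop_eqP => x; apply/ell2_eqP => m; rewrite cmul_bopE !coord_projE.
rewrite [`[< (Y `&` Z) m >]]asbool_and.
by case: `[< Y m >]; case: `[< Z m >].
Qed.

Lemma coord_proj0 : coord_proj set0 = 0.
Proof.
apply/bop_eqP => x; apply/ell2_eqP => m; rewrite coord_projE.
by case: asboolP.
Qed.

Lemma pshift_range a b (ab : mutually_inverse a b) :
  pshift ab ** (pshift ab)^** = coord_proj [set m | a m].
Proof.
rewrite pshift_star; apply/bop_eqP => x; apply/ell2_eqP => m.
rewrite cmul_bopE coord_projE pshiftE /=.
case am : (a m) => [k|] /=; last by case: asboolP.
by rewrite /pull; have /ab-> := am; case: asboolP.
Qed.

Lemma pshift_source a b (ab : mutually_inverse a b) :
  (pshift ab)^** ** pshift ab = coord_proj [set k | b k].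
Proof.
rewrite -{2}(cstarK (pshift ab)) !pshift_star.
by rewrite -(pshift_range (mutually_inverse_sym ab)) pshift_star.
Qed.

Lemma pshift_pisom a b (ab : mutually_inverse a b) :
  partial_isometry (pshift ab).
Proof.
rewrite /partial_isometry pshift_range; apply/bop_eqP => x; apply/ell2_eqP => m.
rewrite cmul_bopE coord_projE pshiftE /=.
by case am : (a m) => [k|] /=; case: asboolP.
Qed.

Lemma coord_proj_neq0 Y : Y !=set0 -> coord_proj Y <> 0.
Proof.
move=> [m Ym].
pose d k : R[i] := (k == m)%:R.
have dsum : d \in @square_summable R.
  apply/asboolP; exists 1 => n; rewrite /ip_part.
  have [mn|nm] := ltnP m n.
    rewrite (bigD1_seq m) ?mem_index_iota ?iota_uniq//= big1 ?addr0.
      by rewrite /d eqxx /dot /= mulr1 mulr0 addr0.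
    by move=> k /negbTE km; rewrite /d km /dot /= !mulr0 addr0.
  rewrite big1_seq// => k /=; rewrite mem_index_iota => kn.
  have -> : d k = 0.
    by rewrite /d ltn_eqF// (leq_trans _ nm)//; case/andP: kn.
  by rewrite /dot /= !mulr0 addr0.
move=> /bop_eqP/(_ (Ell2 dsum))/ell2_eqP/(_ m).
rewrite coord_projE; case: asboolP => // _.
by rewrite /= /d eqxx => /eqP; rewrite oner_eq0.
Qed.

End partial_shift.

(** * A graph family with nonzero vertex projections *)

Lemma partial_inverse_exists (b : nat -> option nat) :
  pinjective b -> exists a, mutually_inverse a b.
Proof.
move=> bi.
suff /choice[a ab] : forall m, exists o, forall k, o = Some k <-> b k = Some m.
  by exists a.
move=> m; have [[k bk]|nk] := pselect (exists k, b k = Some m).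
  by exists (Some k) => l; split=> [[<-]//|bl]; rewrite (bi _ _ _ bk bl).
by exists None => k; split=> // bk; case: nk; exists k.
Qed.

Section coord_proj_sum.
Variables (R : realType) (I : choiceType).

Lemma bop_sumE (r : seq I) (F : I -> bop R) (x : ell2 R) m :
  (\sum_(i <- r) F i) x m = \sum_(i <- r) F i x m.
Proof. by elim/big_rec2 : _ => [|i u w _ <-]. Qed.

Lemma coord_proj_bigcup (A : set I) (Y : I -> set nat) : finite_set A ->
    (forall i j m, A i -> A j -> Y i m -> Y j m -> i = j) ->
  \sum_(i \in A) coord_proj R (Y i) = coord_proj R (\bigcup_(i in A) Y i).
Proof.
move=> fA dY; rewrite fsbig_finite//.
apply/bop_eqP => x; apply/ell2_eqP => m.
rewrite bop_sumE coord_projE; case: asboolP => [[i Ai Yi]|nY].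
  rewrite (bigD1_seq i) ?finmap.fset_uniq ?in_fset_set ?inE//= big1_seq ?addr0.
    by rewrite -[LHS]/(coord_proj R (Y i) x m) coord_projE; case: asboolP.
  move=> j /andP[ji]; rewrite in_fset_set// inE => Aj.
  rewrite -[LHS]/(coord_proj R (Y j) x m) coord_projE; case: asboolP => // Yj.
  by rewrite (dY _ _ _ Aj Ai Yj Yi) eqxx in ji.
rewrite big1_seq// => j /andP[_]; rewrite in_fset_set// inE => Aj.
by rewrite coord_projE; case: asboolP => // Yj; case: nY; exists j.
Qed.

End coord_proj_sum.

Section graph_representation.
Variables (R : realType) (V E : choiceType) (G : digraph V E).

(** The coordinates are indexed by pairs, of which the first component encodes
    the vertex. *)
Lemma vertex_blocks : exists D : V -> set nat,
  (forall v, D v #= [set: nat])%card /\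
  (forall v w m, vertices G v -> vertices G w -> D v m -> D w m -> v = w).
Proof.
have /countable_injP[c ci] := @countable_vertices _ _ G.
exists (fun v => [set pickle (c v, k) | k in [set: nat]]).
split=> [v|v w m Gv Gw].
  apply: inj_card_eq => k l _ _ /(pcan_inj (@pickleK _)).
  by move=> /(congr1 snd).
move=> [k _ <-] [l _ /(pcan_inj (@pickleK _))] /(congr1 fst) /= cvw.
by apply: ci; rewrite ?inE.
Qed.

(** The disjoint union of the blocks of the sources of the edges into [v]. *)
Definition incoming (D : V -> set nat) v : set (E * nat) :=
  [set ek | receives G v ek.1 /\ D (src G ek.1) ek.2].

(** This is where the countability of the set of edges is needed. *)
Lemma card_incoming (D : V -> set nat) v :
  (forall v, D v #= [set: nat])%card -> receives G v !=set0 ->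
  (incoming D v #= [set: nat])%card.
Proof.
move=> cD [e0 ve0]; apply: eq_card_nat.
  apply: (@sub_countable _ _ _ (edges G `*` [set: nat])).
    by apply: subset_card_le => -[e k] [[/= Ge _] _].
  by apply: countableX => //; exact: countable_edges.
move=> fI; apply: infinite_nat.
rewrite -(eq_finite_set (cD (src G e0))).
rewrite -(eq_finite_set (inj_card_eq (f := pair e0) (A := D (src G e0)) _)).
  by apply: sub_finite_set fI => _ [k Dk <-].
by move=> k l _ _ [].
Qed.

Lemma edge_shift (D : V -> set nat) e (h : E * nat -> nat) :
    {in [set ek | ek.1 = e /\ D (src G e) ek.2] &, injective h} ->
  exists T : bop R, [/\ partial_isometry T,
    T ** T^** = coord_proj R [set h (e, k) | k in D (src G e)] &
    T^** ** T = coord_proj R (D (src G e))].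
Proof.
move=> hi.
pose b k := if `[< D (src G e) k >] then Some (h (e, k)) else None.
have bi : pinjective b.
  move=> k l m; rewrite /b; case: asboolP => // Dk [hk].
  case: asboolP => // Dl [hl].
  have /(congr1 snd)// : (e, k) = (e, l).
  by apply: hi; rewrite ?inE//= hk hl.
have [a ab] := partial_inverse_exists bi.
exists (pshift R ab); split; first exact: pshift_pisom.
  rewrite pshift_range; congr coord_proj; apply/seteqP; split=> m /=.
    case am : (a m) => [k|]// _; have /ab := am; rewrite /b.
    by case: asboolP => // Dk [hk]; exists k.
  move=> [k Dk hk]; have -> // : a m = Some k.
  by apply/ab; rewrite /b hk; case: asboolP.
rewrite pshift_source; congr coord_proj; apply/seteqP; split=> m /=.
  by rewrite /b; case: asboolP.
by rewrite /b; case: asboolP.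
Qed.

(** Every block is infinite, so a vertex [v] that receives an edge has a block
    equipotent to [incoming D v].  The images of the edges into [v] then
    partition the whole block, which is the summation relation at [v] when
    they are finitely many. *)
Lemma faithful_graph_family : exists (q : V -> bop R) (t : E -> bop R),
  graph_family G q t /\ forall v, vertices G v -> q v <> 0.
Proof.
have [D [cD dD]] := vertex_blocks.
have /choice[h hbij] : forall v, exists h : E * nat -> nat,
    receives G v !=set0 -> set_bij (incoming D v) (D v) h.
  move=> v; have [rv|nrv] := pselect (receives G v !=set0); last first.
    by exists (fun=> 0%N).
  have : (incoming D v #= D v)%card.
    apply: card_eq_trans (card_incoming cD rv) _.
    by rewrite card_eq_sym; exact: cD.
  by move=> /card_set_bijP[f fb]; exists f.
have hD e k : edges G e -> D (src G e) k -> D (rng G e) (h (rng G e) (e, k)).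
  move=> Ge Dk; have [|hf _ _] := hbij (rng G e); first by exists e.
  by apply: hf; split.
have hinj v : {in incoming D v &, injective (h v)}.
  move=> x y xv; have [|_ hi _] := hbij v; last exact: hi xv.
  by exists x.1; have := xv; rewrite inE => -[].
have /choice[t tP] : forall e, exists T : bop R, edges G e ->
    [/\ partial_isometry T,
      T ** T^** = coord_proj R [set h (rng G e) (e, k) | k in D (src G e)] &
      T^** ** T = coord_proj R (D (src G e))].
  move=> e; have [Ge|nGe] := pselect (edges G e); last by exists 0.
  have [|T TP] := @edge_shift D e (h (rng G e)); last by exists T.
  move=> [e1 k] [e2 l]; rewrite !inE /= => -[-> Dk] [-> Dl].
  by apply: (@hinj (rng G e)); rewrite inE.
pose Y e := [set h (rng G e) (e, k) | k in D (src G e)].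
have dY e f m : edges G e -> edges G f -> Y e m -> Y f m -> e = f.
  move=> Ge Gf [k Dk hk] [l Dl hl].
  have ef : rng G e = rng G f.
    apply: (dD _ _ m); try exact: rng_vertices.
      by rewrite -hk; exact: hD.
    by rewrite -hl; exact: hD.
  have /(congr1 fst)// : (e, k) = (f, l).
  by apply: (@hinj (rng G e)); rewrite ?inE ?hk ?ef ?hl.
exists (fun v => coord_proj R (D v)), t; split; last first.
  move=> v _; apply: coord_proj_neq0.
  have := cD v; rewrite card_eq_sym => /card_set_bijP[f [fD _ _]].
  by exists (f 0%N); exact: fD.
split.
- by move=> v _; exact: coord_projP.
- move=> v w Gv Gw vw; rewrite coord_projM -[RHS](coord_proj0 R).
  congr coord_proj; apply/seteqP; split=> // m [Dv Dw].
  by apply: vw; exact: dD Dv Dw.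
- by move=> e /tP[].
- move=> e f Ge Gf ef; have [_ -> _] := tP e Ge; have [_ -> _] := tP f Gf.
  rewrite coord_projM -[RHS](coord_proj0 R); congr coord_proj.
  by apply/seteqP; split=> // m [Ye Yf]; apply: ef; exact: dY Ye Yf.
- by move=> e /tP[].
- move=> v Gv rv fr.
  transitivity (\sum_(e \in receives G v) coord_proj R (Y e)); last first.
    by apply: eq_fsbigr => e; rewrite inE => -[Ge _]; have [_ ->] := tP e Ge.
  rewrite coord_proj_bigcup//; last by move=> e f m [Ge _] [Gf _]; exact: dY.
  congr coord_proj; apply/seteqP; split=> m.
    have [_ _ hs] := hbij v rv.
    move=> /hs[[e k] [[/= Ge re] Dk] hk]; exists e => //.
    by exists k => //; rewrite re.
  by move=> [e [Ge re] [k Dk <-]]; rewrite -[in X in D X]re; exact: hD.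
- move=> e Ge; have [_ -> _] := tP e Ge.
  have YD : Y e `<=` D (rng G e) by move=> _ [k Dk <-]; exact: hD.
  by split; rewrite coord_projM; congr coord_proj;
    [apply/setIidPl|apply/setIidPr].
Qed.

End graph_representation.

(** * Star-homomorphisms out of sums and out of tuples *)

Section starhom_constructions.
Variable R : realType.
Implicit Types A B C : cstarAlgType R.

Lemma starhom_comp A B C (g : B -> C) (f : A -> B) :
  starhom g -> starhom f -> starhom (g \o f).
Proof.
move=> hg hf; split=> [a x y|x y|x] /=.
- by rewrite (starhomD hf) (starhomZ hf) (starhomD hg) (starhomZ hg).
- by rewrite (starhomM hf) (starhomM hg).
- by rewrite (starhom_star hf) (starhom_star hg).
Qed.

Lemma starhom_id A : starhom (@id A).
Proof. by []. Qed.

Lemma starhom_fsum A B (f : A -> B) (I : choiceType) (S : set I) (F : I -> A) :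
  starhom f -> finite_set S ->
  f (\sum_(i \in S) F i) = \sum_(i \in S) f (F i).
Proof. by move=> hf fS; rewrite !fsbig_finite// (starhom_sum hf). Qed.

Lemma starhom_inl A B : starhom (fun a : A => (a, 0) : A * B).
Proof.
split=> [a x y|x y|x].
- by congr pair; rewrite /= scaler0 addr0.
- by congr pair; rewrite /= cmul0l.
- by congr pair; rewrite /= cstar0.
Qed.

Lemma starhom_pair A B (f : A -> B) (Q : B) : starhom f -> projection Q ->
    (forall a, f a ** Q = 0) -> (forall a, Q ** f a = 0) ->
  starhom (fun x : A * R[i] => f x.1 + x.2 *: Q).
Proof.
move=> hf [Qs QQ] fQ Qf; split=> [a x y|x y|x] /=.
- rewrite (starhomD hf) (starhomZ hf) scalerDr addrACA; congr (_ + _).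
  by rewrite scalerA -scalerDl.
- rewrite (starhomM hf) cmulDl !cmulDr !cmulZl !cmulZr fQ Qf QQ.
  by rewrite !scaler0 addr0 add0r scalerA.
- by rewrite (starhom_star hf) cstarD cstarZ Qs.
Qed.

Lemma is_unit_pair A (u : A) :
  is_unit u -> is_unit ((u, 1) : A * R[i]).
Proof.
move=> hu [x z]; have [ux xu] := hu x.
by split; congr pair; rewrite /= ?ux ?xu//; [exact: mul1r|exact: mulr1].
Qed.

Lemma unital_starhomP A B (f : A -> B) u w : starhom f -> is_unit u ->
  is_unit w -> f u = w -> unital_starhom f.
Proof.
move=> hf hu hw fu; split=> //; [by exists u|by exists w|move=> u' hu'].
by rewrite (is_unit_uniq hu' hu) fu.
Qed.

End starhom_constructions.

Section orthogonal_projections.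
Variables (R : realType) (B : cstarAlgType R) (n : nat) (P : 'I_n -> B).

Definition row_comb (l : 'rV[R[i]]_n) : B := \sum_i l ord0 i *: P i.

Hypothesis Pproj : forall i, projection (P i).
Hypothesis Porth : forall i j, i != j -> P i ** P j = 0.

Lemma row_comb_projr l j : row_comb l ** P j = l ord0 j *: P j.
Proof.
rewrite /row_comb cmul_suml (bigD1 j)//= big1 ?addr0 => [|i ij].
  by rewrite cmulZl; have [_ ->] := Pproj j.
by rewrite cmulZl Porth// scaler0.
Qed.

Lemma row_comb_starhom : starhom row_comb.
Proof.
split=> [a x y|x y|x].
- rewrite /row_comb scaler_sumr -big_split /=; apply: eq_bigr => i _.
  by rewrite !mxE scalerDl scalerA.
- rewrite {3}/row_comb cmul_sumr; apply: eq_bigr => i _.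
  by rewrite cmulZr row_comb_projr !mxE scalerA mulrC.
- rewrite /row_comb cstar_sum; apply: eq_bigr => i _.
  by rewrite !mxE cstarZ; have [->] := Pproj i.
Qed.

Lemma is_unit_row : is_unit (const_mx 1 : 'rV[R[i]]_n).
Proof.
by move=> x; split; apply/rowP => j; rewrite !mxE ?mul1r ?mulr1.
Qed.

(** Multiplying by [P j] isolates the coordinate [j], hence injectivity. *)
Lemma row_comb_unital_embedding :
  is_unit (\sum_i P i) -> (forall i, P i <> 0) -> unital_embedding row_comb.
Proof.
move=> Pu P0; split=> [|x y xy].
  apply: unital_starhomP row_comb_starhom is_unit_row Pu _.
  by apply: eq_bigr => i _; rewrite mxE scale1r.
apply/rowP => j; apply/eqP; rewrite -subr_eq0; apply/negP => /negP d0.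
have : (x ord0 j - y ord0 j) *: P j = 0.
  by rewrite scalerBl -!row_comb_projr xy subrr.
by move/eqP; rewrite scaler_eq0 (negbTE d0) => /eqP; exact: P0.
Qed.

Lemma row_comb_delta i : row_comb (delta_mx 0 i) = P i.
Proof.
rewrite /row_comb (bigD1 i)//= big1 ?addr0 => [|j ji].
  by rewrite mxE !eqxx scale1r.
by rewrite mxE (negbTE ji) andbF scale0r.
Qed.

End orthogonal_projections.

(** Both [theta1] and [theta2] treat the last coordinate apart; this puts
    them in the form [row_comb]. *)
Definition rcons_family (T : Type) n (P : 'I_n -> T) (Q : T)
    (i : 'I_n.+1) : T :=
  oapp P Q (unlift ord_max i).

Lemma rcons_family_widen T n (P : 'I_n -> T) Q i :
  rcons_family P Q (widen_ord (leqnSn n) i) = P i.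
Proof.
have -> : widen_ord (leqnSn n) i = lift ord_max i.
  by apply: val_inj; rewrite [RHS]lift_max.
by rewrite /rcons_family liftK.
Qed.

Lemma rcons_family_max T n (P : 'I_n -> T) Q :
  rcons_family P Q ord_max = Q.
Proof. by rewrite /rcons_family unlift_none. Qed.

Lemma rcons_family_ind (T : Type) n (P : 'I_n -> T) (Q : T) (K : T -> Prop) :
  (forall i, K (P i)) -> K Q -> forall i, K (rcons_family P Q i).
Proof.
move=> KP KQ i; rewrite /rcons_family.
by case: unliftP => [j _|_] /=; [exact: KP|exact: KQ].
Qed.

Lemma rcons_family_orth (R : realType) (B : cstarAlgType R) n
    (P : 'I_n -> B) Q :
    (forall i j, i != j -> P i ** P j = 0) ->
    (forall i, P i ** Q = 0) -> (forall i, Q ** P i = 0) ->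
  forall i j, i != j -> rcons_family P Q i ** rcons_family P Q j = 0.
Proof.
move=> PP PQ QP i j; rewrite /rcons_family.
case: unliftP => [i'|] ->; case: unliftP => [j'|] -> //=; last by rewrite eqxx.
by move=> ij; apply: PP; apply: contraNneq ij => ->.
Qed.

(** * Graph families *)

Section graph_family_lemmas.
Variables (R : realType) (V E : choiceType).
Implicit Types (G H : digraph V E) (A B : cstarAlgType R).

Lemma graph_family_map G A B (f : A -> B) p s : starhom f ->
  graph_family G p s -> graph_family G (f \o p) (f \o s).
Proof.
move=> hf hG; split=> /=.
- move=> v Gv; have [ps pp] := gf_proj hG Gv.
  by split; rewrite -?(starhom_star hf) -?(starhomM hf) ?ps ?pp.
- move=> v w Gv Gw vw.
  by rewrite -(starhomM hf) (gf_proj_orth hG)// (starhom0 hf).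
- move=> e Ge; rewrite /partial_isometry -(starhom_star hf) -!(starhomM hf).
  by rewrite (gf_pisom hG).
- move=> e e' Ge Ge' ee'; rewrite -!(starhom_star hf) -!(starhomM hf).
  by rewrite (gf_range_orth hG)// (starhom0 hf).
- move=> e Ge; rewrite -!(starhom_star hf) -!(starhomM hf).
  by rewrite (gf_source hG).
- move=> v Gv rv fv; rewrite (gf_sum hG Gv rv fv) (starhom_fsum _ hf)//.
  by apply: eq_fsbigr => e _; rewrite (starhomM hf) (starhom_star hf).
- move=> e Ge; have [rp pr] := gf_range hG Ge.
  by split; rewrite -!(starhom_star hf) -!(starhomM hf) ?rp ?pr.
Qed.

(** Only the summation relation of a subgraph does not come directly from the
    larger graph: the subgraph must not lose edges at a vertex where it
    imposes that relation. *)
Lemma graph_family_sub G H A (p : V -> A) (s : E -> A) :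
    subgraph H G ->
    (forall v, vertices H v -> receives H v !=set0 ->
      receives G v = receives H v) ->
  graph_family G p s -> graph_family H p s.
Proof.
move=> [Hv He Hr] rH hG; split.
- by move=> v /Hv; exact: (gf_proj hG).
- by move=> v w /Hv Gv /Hv Gw; exact: (gf_proj_orth hG).
- by move=> e /He; exact: (gf_pisom hG).
- by move=> e f /He Ge /He Gf; exact: (gf_range_orth hG).
- by move=> e HE; have [-> _] := Hr _ HE; apply: (gf_source hG); exact: He.
- move=> v HV rv; rewrite -(rH _ HV rv) => fv.
  by apply: (gf_sum hG) => //; [exact: Hv|rewrite (rH _ HV rv)].
- by move=> e HE; have [_ ->] := Hr _ HE; apply: (gf_range hG); exact: He.
Qed.

Lemma graph_family_ext G A (p q : V -> A) (s t : E -> A) :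
    (forall v, vertices G v -> p v = q v) ->
    (forall e, edges G e -> s e = t e) ->
  graph_family G p s -> graph_family G q t.
Proof.
move=> pq st h; split.
- by move=> v Gv; rewrite -pq//; exact: (gf_proj h).
- by move=> v w Gv Gw; rewrite -!pq//; exact: (gf_proj_orth h).
- by move=> e Ge; rewrite -st//; exact: (gf_pisom h).
- by move=> e f Ge Gf; rewrite -!st//; exact: (gf_range_orth h).
- by move=> e Ge; rewrite -st// -pq; [exact: (gf_source h)|exact: src_vertices].
- move=> v Gv rv fv; rewrite -pq// (gf_sum h Gv rv fv).
  by apply: eq_fsbigr => e; rewrite inE => -[Ge _]; rewrite st.
- by move=> e Ge; rewrite -st// -pq; [exact: (gf_range h)|exact: rng_vertices].
Qed.

Section one_family.
Variables (G : digraph V E) (A : cstarAlgType R) (p : V -> A) (s : E -> A).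
Hypothesis hG : graph_family G p s.

Lemma edge_src e : edges G e -> s e ** p (src G e) = s e.
Proof.
by move=> Ge; rewrite -(gf_source hG Ge) cmulA (gf_pisom hG Ge).
Qed.

Lemma edge_rng e : edges G e -> p (rng G e) ** s e = s e.
Proof.
move=> Ge; have [_ pr] := gf_range hG Ge.
by rewrite -{1}(gf_pisom hG Ge) cmulA pr (gf_pisom hG Ge).
Qed.

Lemma sum_proj_mulr (S : set V) w : finite_set S -> S `<=` vertices G ->
  vertices G w -> (\sum_(v \in S) p v) ** p w = if `[< S w >] then p w else 0.
Proof.
move=> fS SG Gw; rewrite fsbig_finite// cmul_suml.
have orth v : v \in finmap.enum_fset (fset_set S) -> v != w -> p v ** p w = 0.
  rewrite in_fset_set// inE => Sv /eqP vw.
  by rewrite (gf_proj_orth hG)//; exact: SG.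
case: asboolP => Sw.
  rewrite (bigD1_seq w) ?finmap.fset_uniq ?in_fset_set ?inE//= big1_seq.
    by rewrite addr0; have [_] := gf_proj hG Gw.
  by move=> v /andP[vw vS]; exact: orth.
rewrite big1_seq// => v /andP[_ vS]; apply: orth => //.
by apply: contra_notN Sw => /eqP <-; move: vS; rewrite in_fset_set// inE.
Qed.

Lemma sum_proj_star (S : set V) : finite_set S -> S `<=` vertices G ->
  (\sum_(v \in S) p v)^** = \sum_(v \in S) p v.
Proof.
move=> fS SG; rewrite fsbig_finite// cstar_sum big_seq [RHS]big_seq.
apply: eq_bigr => v; rewrite in_fset_set// inE => Sv.
by have [] := gf_proj hG (SG _ Sv).
Qed.

Lemma sum_proj_mull (S : set V) w : finite_set S -> S `<=` vertices G ->
  vertices G w -> p w ** (\sum_(v \in S) p v) = if `[< S w >] then p w else 0.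
Proof.
move=> fS SG Gw; rewrite -[LHS]cstarK cstarM sum_proj_star//.
have [pw _] := gf_proj hG Gw.
by rewrite pw sum_proj_mulr//; case: ifP => _; rewrite ?cstar0 ?pw.
Qed.

Lemma sum_projM (S T : set V) : finite_set S -> finite_set T ->
    S `<=` vertices G -> T `<=` vertices G ->
  (\sum_(v \in S) p v) ** (\sum_(v \in T) p v) =
    \sum_(v \in T) (if `[< S v >] then p v else 0).
Proof.
move=> fS fT SG TG; rewrite (fsbig_finite _ _ fT) [RHS]fsbig_finite//.
rewrite cmul_sumr big_seq [RHS]big_seq; apply: eq_bigr => v.
by rewrite in_fset_set// inE => Tv; rewrite sum_proj_mulr//; exact: TG.
Qed.

Lemma sum_proj_projection (S : set V) : finite_set S -> S `<=` vertices G ->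
  projection (\sum_(v \in S) p v).
Proof.
move=> fS SG; split; first exact: sum_proj_star.
rewrite sum_projM//; apply: eq_fsbigr => v; rewrite inE => Sv.
by case: asboolP.
Qed.

Lemma sum_proj_orth (S T : set V) : finite_set S -> finite_set T ->
    S `<=` vertices G -> T `<=` vertices G -> S `&` T = set0 ->
  (\sum_(v \in S) p v) ** (\sum_(v \in T) p v) = 0.
Proof.
move=> fS fT SG TG ST; rewrite sum_projM//; apply: fsbig1 => v Tv.
by case: asboolP => // Sv; have : (S `&` T) v by []; rewrite ST.
Qed.

End one_family.

(** By the relations [p (rng e) s e = s e = s e p (src e)], the sum of the
    vertex projections is neutral on the generators. *)
Lemma graph_cstar_unit G A (p : V -> A) (s : E -> A) :
  finite_set (vertices G) -> graph_cstar G p s ->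
  is_unit (\sum_(v \in vertices G) p v).
Proof.
move=> fG hA; have hG := gc_family hA.
apply: (generated_unit (gc_generated hA)).
- exact: (sum_proj_star hG).
- move=> x [[v Gv <-]|[e Ge <-]].
    by rewrite (sum_proj_mulr hG)//; case: asboolP.
  rewrite -{1}(edge_rng hG Ge) cmulA (sum_proj_mulr hG)//; last first.
    exact: rng_vertices.
  by case: asboolP => [_|]; [rewrite (edge_rng hG)|case; exact: rng_vertices].
- move=> x [[v Gv <-]|[e Ge <-]].
    by rewrite (sum_proj_mull hG)//; case: asboolP.
  rewrite -{1}(edge_src hG Ge) -cmulA (sum_proj_mull hG)//; last first.
    exact: src_vertices.
  by case: asboolP => [_|]; [rewrite (edge_src hG)|case; exact: src_vertices].
Qed.

(** The universal property maps [p v] to a nonzero projection. *)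
Lemma graph_cstar_proj_neq0 G A (p : V -> A) (s : E -> A) v :
  graph_cstar G p s -> vertices G v -> p v <> 0.
Proof.
move=> hA Gv pv; have [q [t [hq q0]]] := faithful_graph_family R G.
have [f [hf fp _]] := gc_universal hA hq.
by apply: (q0 _ Gv); rewrite -fp// pv (starhom0 hf).
Qed.

Lemma graph_starhom_ext G A B (p : V -> A) (s : E -> A) (f g : A -> B) :
    graph_cstar G p s -> starhom f -> starhom g ->
    (forall v, vertices G v -> f (p v) = g (p v)) ->
    (forall e, edges G e -> f (s e) = g (s e)) ->
  f =1 g.
Proof.
move=> hA hf hg fgp fgs; apply: (starhom_ext (gc_generated hA) hf hg) => x.
by rewrite inE => -[[v Gv <-]|[e Ge <-]]; [exact: fgp|exact: fgs].
Qed.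

Section union.
Variables (G G1 G2 : digraph V E).
Hypothesis GU : graph_union G G1 G2.
Hypothesis no_entry : no_edge_enters G2 G1.

Lemma subgraph1 : subgraph G1 G. Proof. by case: GU. Qed.
Lemma subgraph2 : subgraph G2 G. Proof. by case: GU. Qed.

(** An edge of [G2] ending at [v] would enter [G1]. *)
Lemma receives1 v : vertices G1 v -> receives G v = receives G1 v.
Proof.
have [s1v s1e s1r] := subgraph1; have [s2v s2e s2r] := subgraph2.
move=> G1v; apply/seteqP; split=> e [Ge re]; last first.
  by split; [exact: s1e|rewrite -re; have [] := s1r _ Ge].
case: GU => _ _ _ eU; move: (Ge); rewrite eU => -[G1e|G2e].
  by split=> //; rewrite -re; have [] := s1r _ G1e.
case: (no_entry G2e); have [_ ->] := s2r _ G2e.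
by rewrite re.
Qed.

(** The edges of [G1] end at vertices of [G1]. *)
Lemma receives2 v : ~ vertices G1 v -> receives G v = receives G2 v.
Proof.
have [s1v s1e s1r] := subgraph1; have [s2v s2e s2r] := subgraph2.
move=> G1v; apply/seteqP; split=> e [Ge re]; last first.
  by split; [exact: s2e|rewrite -re; have [] := s2r _ Ge].
case: GU => _ _ _ eU; move: (Ge); rewrite eU => -[G1e|G2e].
  case: G1v; rewrite -re; have [_ <-] := s1r _ G1e; exact: rng_vertices.
by split=> //; rewrite -re; have [] := s2r _ G2e.
Qed.

Lemma graph_family_sub1 A (p : V -> A) (s : E -> A) :
  graph_family G p s -> graph_family G1 p s.
Proof.
by apply: graph_family_sub subgraph1 _ => v G1v _; exact: receives1.
Qed.

Lemma graph_family_sub2 A (p : V -> A) (s : E -> A) :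
  graph_family G p s -> graph_family G2 p s.
Proof.
apply: graph_family_sub subgraph2 _ => v G2v [e [G2e re]]; apply: receives2.
by rewrite -re; exact: no_entry.
Qed.

(** Relations at one vertex or at one edge live in one of the subgraphs.  The
    only mixed ones are the orthogonality of the ranges of an edge of [G1] and
    an edge of [G2], which are dominated by projections of distinct vertices. *)
Lemma graph_family_glue A (p : V -> A) (s : E -> A) :
    vertices G2 = vertices G ->
  graph_family G1 p s -> graph_family G2 p s -> graph_family G p s.
Proof.
move=> vG h1 h2.
have [s1v s1e s1r] := subgraph1; have [s2v s2e s2r] := subgraph2.
have eU e : edges G e -> edges G1 e \/ edges G2 e by case: GU => _ _ _ ->.
have cross e f : edges G1 e -> edges G2 f ->
    s e ** (s e)^** ** (s f ** (s f)^**) = 0 /\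
    s f ** (s f)^** ** (s e ** (s e)^**) = 0.
  move=> G1e G2f.
  have [ep pe] := gf_range h1 G1e; have [fp pf] := gf_range h2 G2f.
  have ne : rng G1 e <> rng G2 f.
    by move=> ef; apply: (no_entry G2f); rewrite -ef; exact: rng_vertices.
  have Ge : vertices G2 (rng G1 e) by rewrite vG; apply/s1v/rng_vertices.
  have Gf : vertices G2 (rng G2 f) by exact: rng_vertices.
  split.
    by rewrite -ep -pf -cmulA [p _ ** (p _ ** _)]cmulA
      (gf_proj_orth h2)// cmul0l cmul0r.
  by rewrite -pe -fp -cmulA [p _ ** (p _ ** _)]cmulA
    (gf_proj_orth h2)// ?cmul0l ?cmul0r//; exact: nesym.
split.
- by move=> v; rewrite -vG; exact: (gf_proj h2).
- by move=> v w; rewrite -vG; exact: (gf_proj_orth h2).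
- by move=> e /eU[]; [exact: (gf_pisom h1)|exact: (gf_pisom h2)].
- move=> e f /eU[Ge|Ge] /eU[Gf|Gf] ef.
  + exact: (gf_range_orth h1).
  + by have [] := cross _ _ Ge Gf.
  + by have [] := cross _ _ Gf Ge.
  + exact: (gf_range_orth h2).
- move=> e /eU[Ge|Ge].
    by have [<- _] := s1r _ Ge; exact: (gf_source h1).
  by have [<- _] := s2r _ Ge; exact: (gf_source h2).
- move=> v Gv; have [G1v|G1v] := pselect (vertices G1 v).
    by rewrite receives1//; exact: (gf_sum h1).
  by rewrite receives2//; apply: (gf_sum h2); rewrite vG.
- move=> e /eU[Ge|Ge].
    by have [_ <-] := s1r _ Ge; exact: (gf_range h1).
  by have [_ <-] := s2r _ Ge; exact: (gf_range h2).
Qed.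

End union.

End graph_family_lemmas.

(** * The amalgamated free product *)

Section amalgam.
Variables (R : realType) (V E : choiceType) (G G1 G2 : digraph V E).
Hypothesis G_finite : finite_set (vertices G).
Hypothesis GU : graph_union G G1 G2.
Hypothesis no_shared_edge : edges G1 `&` edges G2 = set0.
Hypothesis G2_vertices : vertices G2 = vertices G.
Hypothesis G1_vertices : vertices G1 <> vertices G.
Hypothesis no_entry : no_edge_enters G2 G1.
Variables (n : nat) (v : 'I_n -> V).
Hypothesis v_inj : injective v.
Hypothesis v_shared : range v = vertices G1 `&` vertices G2.
Variables (A1 : cstarAlgType R) (p1 : V -> A1) (s1 : E -> A1).
Hypothesis A1_graph : graph_cstar G1 p1 s1.
Variables (A2 : cstarAlgType R) (p2 : V -> A2) (s2 : E -> A2).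
Hypothesis A2_graph : graph_cstar G2 p2 s2.

Let W := vertices G2 `\` vertices G1.

Lemma G1_sub : vertices G1 `<=` vertices G.
Proof. by case: GU => -[]. Qed.

Lemma G1_sub2 : vertices G1 `<=` vertices G2.
Proof. by rewrite G2_vertices; exact: G1_sub. Qed.

Lemma finite_G1 : finite_set (vertices G1).
Proof. exact: sub_finite_set G1_sub G_finite. Qed.

Lemma finite_G2 : finite_set (vertices G2).
Proof. by rewrite G2_vertices. Qed.

Lemma W_sub : W `<=` vertices G2.
Proof. by move=> w []. Qed.

Lemma finite_W : finite_set W.
Proof. exact: sub_finite_set W_sub finite_G2. Qed.

(** As [G2] has all the vertices, the shared ones are those of [G1]. *)
Lemma range_v : range v = vertices G1.
Proof. by rewrite v_shared; apply/setIidPl; exact: G1_sub2. Qed.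

Lemma v_G1 i : vertices G1 (v i).
Proof. by rewrite -range_v; exists i. Qed.

Lemma W_nonempty : W !=set0.
Proof.
apply/set0P/negP => /eqP W0; apply: G1_vertices; apply/seteqP; split.
  exact: G1_sub.
move=> w Gw; apply: contrapT => nw.
by have : W w; [split; rewrite ?G2_vertices|rewrite W0].
Qed.

Lemma v_neq i j : i != j -> v i <> v j.
Proof. by move=> /eqP ij /v_inj. Qed.

Lemma sum_v (B : nmodType) (f : V -> B) :
  \sum_(i < n) f (v i) = \sum_(w \in vertices G1) f w.
Proof.
have -> : vertices G1 = [set` map v (enum 'I_n)].
  rewrite -range_v; apply/seteqP; split=> w /=.
    by move=> [i _ <-]; rewrite map_f ?mem_enum.
  by move=> /mapP[i _ ->]; exists i.
rewrite -fsbig_seq; first by rewrite big_map big_enum.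
by rewrite map_inj_uniq ?enum_uniq.
Qed.

Let fam1 := gc_family A1_graph.
Let fam2 := gc_family A2_graph.
Let Q2 : A2 := \sum_(w \in W) p2 w.
(** The images of the standard basis vectors under [theta1] and [theta2]. *)
Let atom1 := rcons_family (fun i => (p1 (v i), 0) : A1 * R[i]) (0, 1).
Let atom2 := rcons_family (fun i => p2 (v i)) Q2.

Lemma theta1E : theta1 v p1 = row_comb atom1.
Proof.
apply/funext => l; rewrite /theta1 /row_comb big_ord_recr /= /atom1.
rewrite rcons_family_max; under [in RHS]eq_bigr do rewrite rcons_family_widen.
have -> : \sum_(i < n) l ord0 (widen_ord (leqnSn n) i) *: (p1 (v i), 0 : R[i]) =
    (\sum_(i < n) l ord0 (widen_ord (leqnSn n) i) *: p1 (v i), 0).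
  rewrite (starhom_sum (starhom_inl A1 R[i])); apply: eq_bigr => i _.
  by rewrite (starhomZ (starhom_inl A1 R[i])).
by congr pair; rewrite /= ?scaler0 ?addr0// add0r [RHS]mulr1.
Qed.

Lemma theta2E : theta2 v G1 G2 p2 = row_comb atom2.
Proof.
apply/funext => l; rewrite /theta2 /row_comb big_ord_recr /= /atom2.
rewrite rcons_family_max.
by under [in RHS]eq_bigr do rewrite rcons_family_widen.
Qed.

Lemma atom2_proj i : projection (atom2 i).
Proof.
apply: rcons_family_ind i => [i|].
  by apply: (gf_proj fam2); apply: G1_sub2; exact: v_G1.
apply: (sum_proj_projection fam2); [exact: finite_W|exact: W_sub].
Qed.

Lemma atom2_orth i j : i != j -> atom2 i ** atom2 j = 0.
Proof.
have G2v k : vertices G2 (v k) by apply: G1_sub2; exact: v_G1.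
apply: rcons_family_orth => [k l kl|k|k].
- by apply: (gf_proj_orth fam2) => //; exact: v_neq.
- rewrite (sum_proj_mull fam2 finite_W W_sub)//; case: asboolP => // -[_ nG1].
  by case: nG1; exact: v_G1.
- rewrite (sum_proj_mulr fam2 finite_W W_sub)//; case: asboolP => // -[_ nG1].
  by case: nG1; exact: v_G1.
Qed.

Lemma atom2_unit : is_unit (\sum_i atom2 i).
Proof.
have -> : \sum_i atom2 i = \sum_(w \in vertices G2) p2 w.
  rewrite big_ord_recr /= /atom2 rcons_family_max.
  under eq_bigr do rewrite rcons_family_widen.
  rewrite sum_v (fsbigID (vertices G1) _ _ finite_G2); congr (_ + _).
  by congr (\sum_(w \in _) _); apply/esym/setIidPr; exact: G1_sub2.
exact: graph_cstar_unit finite_G2 A2_graph.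
Qed.

Lemma atom2_neq0 i : atom2 i <> 0.
Proof.
apply: (@rcons_family_ind _ _ _ _ (fun x => x <> 0)) i => [i|].
  by apply: (graph_cstar_proj_neq0 A2_graph); apply: G1_sub2; exact: v_G1.
have [w Ww] := W_nonempty => Q0.
apply: (graph_cstar_proj_neq0 A2_graph (W_sub Ww)).
have := sum_proj_mulr fam2 finite_W W_sub (W_sub Ww).
by case: asboolP => // _ <-; rewrite -/Q2 Q0 cmul0l.
Qed.

Lemma theta2_embedding :
  unital_embedding (theta2 v G1 G2 p2 : 'rV[R[i]]_n.+1 -> A2).
Proof.
rewrite theta2E; apply: row_comb_unital_embedding.
- exact: atom2_proj.
- exact: atom2_orth.
- exact: atom2_unit.
- exact: atom2_neq0.
Qed.

Lemma atom1_proj i : projection (atom1 i).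
Proof.
apply: rcons_family_ind i => [i|].
  have [ps pp] := gf_proj fam1 (v_G1 i).
  by split; congr pair; rewrite //= ?cstar0 ?cmul0l.
split; congr pair; rewrite /= ?cstar0 ?cmul0l//; last exact: mul1r.
exact: rmorph1.
Qed.

Lemma atom1_orth i j : i != j -> atom1 i ** atom1 j = 0.
Proof.
apply: rcons_family_orth => [k l kl|k|k].
- congr pair; rewrite /= ?cmul0l//.
  by apply: (gf_proj_orth fam1); [exact: v_G1|exact: v_G1|exact: v_neq].
- by congr pair; rewrite /= ?cmul0l ?cmul0r.
- by congr pair; rewrite /= ?cmul0l ?cmul0r.
Qed.

Let u1 := \sum_(w \in vertices G1) p1 w.

Lemma u1_unit : is_unit u1.
Proof. exact: graph_cstar_unit finite_G1 A1_graph. Qed.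

Lemma atom1_unit : is_unit (\sum_i atom1 i).
Proof.
have -> : \sum_i atom1 i = (u1, 1).
  rewrite big_ord_recr /= /atom1 rcons_family_max.
  under eq_bigr do rewrite rcons_family_widen.
  rewrite /u1 -sum_v -(starhom_sum (starhom_inl A1 R[i])).
  by congr pair; rewrite /= ?addr0 ?add0r.
exact/is_unit_pair/u1_unit.
Qed.

Lemma atom1_neq0 i : atom1 i <> 0.
Proof.
apply: (@rcons_family_ind _ _ _ _ (fun x => x <> 0)) i => [i [pv0]|[]].
  exact: (graph_cstar_proj_neq0 A1_graph (v_G1 i)).
by move/eqP; rewrite oner_eq0.
Qed.

Lemma theta1_embedding :
  unital_embedding (theta1 v p1 : 'rV[R[i]]_n.+1 -> (A1 * R[i])%type).
Proof.
rewrite theta1E; apply: row_comb_unital_embedding.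
- exact: atom1_proj.
- exact: atom1_orth.
- exact: atom1_unit.
- exact: atom1_neq0.
Qed.

Section isomorphism.
Variables (A : cstarAlgType R) (p : V -> A) (s : E -> A).
Hypothesis A_graph : graph_cstar G p s.
Variables (C : cstarAlgType R) (iA : (A1 * R[i])%type -> C) (iB : A2 -> C).
Hypothesis afp :
  amalgamated_free_product (theta1 v p1) (theta2 v G1 G2 p2) iA iB.

Let hiA : starhom iA. Proof. by case: (afp_iA afp) => -[]. Qed.
Let hiB : starhom iB. Proof. by case: (afp_iB afp) => -[]. Qed.
Let hinl : starhom (fun a : A1 => iA (a, 0)).
Proof. exact: starhom_comp hiA (starhom_inl A1 R[i]). Qed.

Lemma amalgam_family i : iA (atom1 i) = iB (atom2 i).
Proof.
have /(congr1 (fun k => k (delta_mx 0 i))) /= := afp_amalgam afp.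
by rewrite theta1E theta2E !row_comb_delta.
Qed.

Lemma amalgam_vertex w : vertices G1 w -> iA (p1 w, 0) = iB (p2 w).
Proof.
rewrite -range_v => -[i _ <-]; have := amalgam_family (widen_ord (leqnSn n) i).
by rewrite /atom1 /atom2 !rcons_family_widen.
Qed.

Lemma amalgam_rest : iA (0, 1) = iB Q2.
Proof.
by have := amalgam_family ord_max; rewrite /atom1 /atom2 !rcons_family_max.
Qed.

Let glued_edge e : C := if `[< edges G1 e >] then iA (s1 e, 0) else iB (s2 e).

Lemma glued_edge1 e : edges G1 e -> glued_edge e = iA (s1 e, 0).
Proof. by rewrite /glued_edge; case: asboolP. Qed.

Lemma glued_edge2 e : edges G2 e -> glued_edge e = iB (s2 e).
Proof.
move=> G2e; rewrite /glued_edge; case: asboolP => // G1e.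
by have : (edges G1 `&` edges G2) e by []; rewrite no_shared_edge.
Qed.

Lemma free_product_family : graph_family G (iB \o p2) glued_edge.
Proof.
apply: (graph_family_glue GU no_entry G2_vertices).
  apply: (graph_family_ext _ _ (graph_family_map hinl fam1))
    => [w G1w|e G1e] /=.
    exact: amalgam_vertex.
  by rewrite glued_edge1.
apply: (graph_family_ext _ _ (graph_family_map hiB fam2)) => [//|e G2e] /=.
by rewrite glued_edge2.
Qed.

Let fam := gc_family A_graph.
Let Q := \sum_(w \in W) p w.

Let W_G : W `<=` vertices G. Proof. by rewrite -G2_vertices; exact: W_sub. Qed.

Lemma Q_proj : projection Q.
Proof. exact: (sum_proj_projection fam finite_W W_G). Qed.

(** [f] comes from the family [glued_edge], and [g] from the restrictions [r1]
    and [r2] of the family of [A] to [G1] and [G2], the extra copy of the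
    scalars being sent to the multiples of the projection [Q] of the vertices
    outside [G1].  They are mutually inverse on generators. *)
Lemma star_isomorphic_graph_free_product : star_isomorphic A C.
Proof.
have [f [hf fp fs]] := gc_universal A_graph free_product_family.
have [r1 [hr1 r1p r1s]] :=
  gc_universal A1_graph (graph_family_sub1 GU no_entry fam).
have [r2 [hr2 r2p r2s]] :=
  gc_universal A2_graph (graph_family_sub2 GU no_entry fam).
have uA := graph_cstar_unit G_finite A_graph.
have r1u : r1 u1 = \sum_(w \in vertices G1) p w.
  rewrite /u1 (starhom_fsum _ hr1 finite_G1); apply: eq_fsbigr => w.
  by rewrite inE; exact: r1p.
(* [u1] is the unit of [A1], so [r1] takes its values under [r1 u1] *)
have G1W : vertices G1 `&` W = set0.
  by apply/seteqP; split=> // w [G1w [_]].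
have r1Q a : r1 a ** Q = 0.
  have [_ <-] := u1_unit a; rewrite (starhomM hr1) r1u -cmulA.
  rewrite (sum_proj_orth fam finite_G1 finite_W G1_sub W_G G1W).
  exact: cmul0r.
have Qr1 a : Q ** r1 a = 0.
  have [<- _] := u1_unit a; rewrite (starhomM hr1) r1u cmulA.
  rewrite (sum_proj_orth fam finite_W finite_G1 W_G G1_sub) ?cmul0l//.
  by rewrite setIC.
pose piA (x : A1 * R[i]) := r1 x.1 + x.2 *: Q.
have hpiA : starhom piA by exact: starhom_pair hr1 Q_proj r1Q Qr1.
have r2Q : r2 Q2 = Q.
  rewrite /Q2 (starhom_fsum _ hr2 finite_W); apply: eq_fsbigr => w.
  by rewrite inE => /W_sub; exact: r2p.
have r2u : r2 (\sum_(w \in vertices G2) p2 w) = \sum_(w \in vertices G) p w.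
  rewrite (starhom_fsum _ hr2 finite_G2) -G2_vertices; apply: eq_fsbigr => w.
  by rewrite inE; exact: r2p.
have piAu : piA (u1, 1) = \sum_(w \in vertices G) p w.
  rewrite /piA /= scale1r r1u -G2_vertices.
  rewrite (fsbigID (vertices G1) _ _ finite_G2).
  congr (_ + _); congr (\sum_(w \in _) _); apply/esym/setIidPr; exact: G1_sub2.
have upiA : unital_starhom piA.
  exact: unital_starhomP hpiA (is_unit_pair u1_unit) uA piAu.
have ur2 : unital_starhom r2.
  exact: unital_starhomP hr2 (graph_cstar_unit finite_G2 A2_graph) uA r2u.
have piAB : piA \o theta1 v p1 = r2 \o theta2 v G1 G2 p2.
  apply/funext => l /=; rewrite theta1E theta2E /row_comb.
  rewrite (starhom_sum hpiA) (starhom_sum hr2); apply: eq_bigr => i _.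
  rewrite (starhomZ hpiA) (starhomZ hr2); congr (_ *: _).
  rewrite /atom1 /atom2 /rcons_family; case: unliftP => [j _|_] /=; last first.
    by rewrite /piA /= (starhom0 hr1) add0r scale1r.
  rewrite /piA /= scale0r addr0 r1p ?r2p//; last exact: v_G1.
  by apply: G1_sub2; exact: v_G1.
have [g [[hg _ _ _] giA giB]] := afp_universal afp upiA ur2 piAB.
have gA x : g (iA x) = piA x by rewrite -giA.
have gB b : g (iB b) = r2 b by rewrite -giB.
exists f; split=> //; exists g.
- have hgf := starhom_comp hg hf.
  apply: (graph_starhom_ext A_graph hgf (starhom_id A)) => [w Gw|e Ge] /=.
    by rewrite fp//= gB r2p// G2_vertices.
  rewrite fs//; have [_ _ _ eU] := GU; move: (Ge); rewrite eU => -[G1e|G2e].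
    by rewrite glued_edge1// gA /piA /= scale0r addr0 r1s.
  by rewrite glued_edge2// gB r2s.
- have fr1 a : f (r1 a) = iA (a, 0).
    apply: (graph_starhom_ext A1_graph (starhom_comp hf hr1) hinl)
      => [w G1w|e G1e] /=.
      by rewrite r1p// fp ?amalgam_vertex//; exact: G1_sub.
    by rewrite r1s// fs ?glued_edge1//; case: GU => -[_ H _] _ _ _; exact: H.
  have fr2 b : f (r2 b) = iB b.
    apply: (graph_starhom_ext A2_graph (starhom_comp hf hr2) hiB)
      => [w G2w|e G2e] /=.
      by rewrite r2p// fp// -G2_vertices.
    by rewrite r2s// fs ?glued_edge2//; case: GU => _ [_ H _] _ _; exact: H.
  have hfg := starhom_comp hf hg.
  apply: (starhom_ext (afp_generated afp) hfg (starhom_id C)) => x.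
  rewrite inE => -[[[a l] _ <-]|[b _ <-]] /=; last by rewrite gB fr2.
  rewrite gA /piA /= (starhomD hf) (starhomZ hf) fr1 -r2Q fr2 -amalgam_rest.
  rewrite -(starhomZ hiA) -(starhomD hiA); congr iA.
  by congr pair; rewrite /= ?scaler0 ?addr0// add0r [LHS]mulr1.
Qed.

End isomorphism.

End amalgam.

Theorem theorem3p2 (R : realType) (V E : choiceType)
    (G G1 G2 : digraph V E)
    (G_finite : finite_set (vertices G))
    (G_union : graph_union G G1 G2)
    (G1_nonempty : nonempty_graph G1)
    (G2_nonempty : nonempty_graph G2)
    (no_shared_edge : edges G1 `&` edges G2 = set0)
    (G2_vertices : vertices G2 = vertices G)
    (G1_vertices : vertices G1 <> vertices G)
    (no_entry : no_edge_enters G2 G1)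
    (n : nat) (v : 'I_n -> V)
    (v_inj : injective v)
    (v_shared : range v = vertices G1 `&` vertices G2)
    (A : cstarAlgType R) (p : V -> A) (s : E -> A)
    (A_graph : graph_cstar G p s)
    (A1 : cstarAlgType R) (p1 : V -> A1) (s1 : E -> A1)
    (A1_graph : graph_cstar G1 p1 s1)
    (A2 : cstarAlgType R) (p2 : V -> A2) (s2 : E -> A2)
    (A2_graph : graph_cstar G2 p2 s2) :
  [/\ unital_embedding (theta1 v p1 : 'rV[R[i]]_n.+1 -> (A1 * R[i])%type),
      unital_embedding (theta2 v G1 G2 p2 : 'rV[R[i]]_n.+1 -> A2) &
      forall (C : cstarAlgType R)
             (iA : (A1 * R[i])%type -> C) (iB : A2 -> C),
        amalgamated_free_product (theta1 v p1) (theta2 v G1 G2 p2) iA iB ->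
        star_isomorphic A C].
Proof.
split.
- exact (theta1_embedding G_finite G_union G2_vertices v_inj v_shared A1_graph).
- exact (theta2_embedding G_finite G_union G2_vertices G1_vertices v_inj
    v_shared A2_graph).
- by move=> C iA iB; exact: (star_isomorphic_graph_free_product G_finite
    G_union no_shared_edge G2_vertices no_entry v_shared A1_graph A2_graph
    A_graph).
Qed.
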